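(* Let $m_1,m_2,m_3,m_4\in\mathbb{N}$ and $\epsilon\in\{0,1\}$, let $n_i=8m_i+4\epsilon+2$ for $i=1,2,3,4$, $n=n_1+n_2+n_3+n_4$, and let $L\subset\mathbb{R}^n$ be the lattice defined in the context. Then $L$ is a positive definite even unimodular lattice with theta series \begin{align*} \Theta_L(z)=&\tfrac12h_{m_1+m_2+m_3+m_4+2\epsilon+1}(z)-32\Delta_{24}(z)\big(\rho_{m_1+m_2+\epsilon-1}(z)\rho_{m_3+m_4+\epsilon-1}(z)\\ &+\rho_{m_1+m_3+\epsilon-1}(z)\rho_{m_2+m_4+\epsilon-1}(z)+\rho_{m_1+m_4+\epsilon-1}(z)\rho_{m_2+m_3+\epsilon-1}(z)\big), \end{align*} where $\rho_{-1}:=0$.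
   Context: Functions: for $\mathrm{Im}(z)>0$, $q=e^{\pi\sqrt{-1}z}$, $\vartheta_2(z)=\sum_{m\in\mathbb{Z}}q^{(m+1/2)^2}$, $\vartheta_3(z)=\sum_{m\in\mathbb{Z}}q^{m^2}$, $\vartheta_4(z)=\sum_{m\in\mathbb{Z}}(-q)^{m^2}$; $\Delta_{24}(z)=\left(\frac{\vartheta_2\vartheta_3\vartheta_4}{2}\right)^8$; for $n\in\mathbb{N}$, $h_n=\vartheta_2^{8n}+\vartheta_3^{8n}+\vartheta_4^{8n}$ and $\rho_n=\dfrac{\vartheta_3^{8(n+1)+4}-\vartheta_2^{8(n+1)+4}-\vartheta_4^{8(n+1)+4}}{(\vartheta_2\vartheta_3\vartheta_4)^4}$; by convention $\rho_{-1}=0$. Lattice: equip $\mathbb{R}^n$ with the standard inner product $\langle\cdot,\cdot\rangle$. A lattice $L\subset\mathbb{R}^n$ is even if $\langle\alpha,\alpha\rangle\in2\mathbb{Z}$ for $\alpha\in L$ and unimodular if $L=\{\alpha\in\mathbb{R}^n:\langle\alpha,\beta\rangle\in\mathbb{Z}\ \forall\beta\in L\}$; its theta series is $\Theta_L(z)=\sum_{\alpha\in L}q^{\langle\alpha,\alpha\rangle}$. Set $\bar n_0=0$, $\bar n_i=n_1+\cdots+n_i$, and $Q=\{(\alpha_1,\dots,\alpha_n)\in\mathbb{Z}^n:\sum_{j=1}^{n_i}\alpha_{\bar n_{i-1}+j}\in2\mathbb{Z}\text{ for } i=1,\dots,4\}$. With $\mathbf 0_j,\mathbf 1_j\in\mathbb{R}^j$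 the all-zero and all-one vectors, let $x^i_1=\frac12(\mathbf 0_{\bar n_{i-1}},\mathbf 1_{n_i},\mathbf 0_{n-\bar n_i})$, $x^i_2=(\mathbf 0_{\bar n_{i-1}},1,\mathbf 0_{n-\bar n_{i-1}-1})$, $x^i_3=x^i_1+x^i_2$. Define $$L=\mathbb{Z}(x^1_2+x^3_3+x^4_3)+\mathbb{Z}(x^2_2+x^4_3+x^1_3)+\mathbb{Z}(x^3_2+x^1_3+x^2_3)+\mathbb{Z}(x^4_2+x^2_3+x^3_3)+Q.$$ *)

(* Defs.v *)
From Stdlib Require Import Reals ZArith List ClassicalEpsilon.
From Coquelicot Require Import Coquelicot.
Open Scope R_scope.

Definition Cexp (w : C) : C :=
  (exp (Re w) * cos (Im w), exp (Re w) * sin (Im w)).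

Fixpoint Cpow (w : C) (k : nat) : C :=
  match k with O => RtoC 1 | S k' => Cmult w (Cpow w k') end.

Definition qn (z : C) : C := Cexp (Cmult (RtoC PI) (Cmult Ci z)).
Definition qpow (z : C) (x : R) : C := Cexp (Cmult (RtoC (PI * x)) (Cmult Ci z)).

Definition sumC {T} (f : T -> C) (G : list T) : C :=
  fold_right (fun x acc => Cplus (f x) acc) (RtoC 0) G.

(* Unconditional summation of a family (f a)_{a in A}: the net of finite
   partial sums (over finite subsets of A, ordered by inclusion) converges to S. *)
Definition HasSum {T} (A : T -> Prop) (f : T -> C) (S : C) : Prop :=
  forall eps : R, eps > 0 ->
    exists F : list T, NoDup F /\ List.Forall A F /\
      forall G : list T, NoDup G -> List.Forall A G -> incl F G ->
        Cmod (Cminus (sumC f G) S) < eps.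

(* the sum of a family indexed by Z (chosen; meaningful when it converges) *)
Definition tsumZ (f : Z -> C) : C :=
  epsilon (inhabits (RtoC 0)) (fun S => HasSum (fun _ : Z => True) f S).

Definition theta2 (z : C) : C :=
  tsumZ (fun m => qpow z ((IZR m + / 2) ^ 2)).
Definition theta3 (z : C) : C :=
  tsumZ (fun m => Cpow (qn z) (Z.to_nat (m * m))).
Definition theta4 (z : C) : C :=
  tsumZ (fun m => Cpow (Copp (qn z)) (Z.to_nat (m * m))).

Definition Delta24 (z : C) : C :=
  Cpow (Cdiv (Cmult (Cmult (theta2 z) (theta3 z)) (theta4 z)) (RtoC 2)) 8.

Definition hh (k : nat) (z : C) : C :=
  Cplus (Cplus (Cpow (theta2 z) (8 * k)) (Cpow (theta3 z) (8 * k)))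
        (Cpow (theta4 z) (8 * k)).

(* rho_k for k : Z, with the convention rho_k = 0 for k < 0 (only k = -1 occurs) *)
Definition rho (k : Z) (z : C) : C :=
  if (k <? 0)%Z then RtoC 0 else
  let e := (8 * (Z.to_nat k + 1) + 4)%nat in
  Cdiv (Cminus (Cminus (Cpow (theta3 z) e) (Cpow (theta2 z) e)) (Cpow (theta4 z) e))
       (Cpow (Cmult (Cmult (theta2 z) (theta3 z)) (theta4 z)) 4).

(* vectors of R^n are represented as functions nat -> R vanishing at indices >= n *)
Definition inRn (n : nat) (v : nat -> R) : Prop := forall k, (n <= k)%nat -> v k = 0.

Fixpoint sumR (n : nat) (f : nat -> R) : R :=
  match n with O => 0 | S k => sumR k f + f k end.

Definition ip (n : nat) (a b : nat -> R) : R := sumR n (fun k => a k * b k).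

(* block sizes: ns 1 = n_1, ..., ns 4 = n_4 *)
Definition nbar (ns : nat -> nat) (i : nat) : nat :=
  fold_right Nat.add 0%nat (map ns (seq 1 i)).

Definition xv1 (ns : nat -> nat) (i : nat) (k : nat) : R :=
  if andb (Nat.leb (nbar ns (i - 1)) k) (Nat.ltb k (nbar ns i)) then / 2 else 0.
Definition xv2 (ns : nat -> nat) (i : nat) (k : nat) : R :=
  if Nat.eqb k (nbar ns (i - 1)) then 1 else 0.
Definition xv3 (ns : nat -> nat) (i : nat) (k : nat) : R :=
  xv1 ns i k + xv2 ns i k.

Definition inQ (ns : nat -> nat) (a : nat -> R) : Prop :=
  inRn (nbar ns 4) a /\
  (exists za : nat -> Z, forall k, a k = IZR (za k)) /\
  (forall i, (1 <= i <= 4)%nat ->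
     exists t : Z, sumR (ns i) (fun j => a (nbar ns (i - 1) + j)%nat) = 2 * IZR t).

Definition gen (ns : nat -> nat) (j : nat) (k : nat) : R :=
  match j with
  | 1%nat => xv2 ns 1 k + xv3 ns 3 k + xv3 ns 4 k
  | 2%nat => xv2 ns 2 k + xv3 ns 4 k + xv3 ns 1 k
  | 3%nat => xv2 ns 3 k + xv3 ns 1 k + xv3 ns 2 k
  | 4%nat => xv2 ns 4 k + xv3 ns 2 k + xv3 ns 3 k
  | _ => 0
  end.

Definition inL (ns : nat -> nat) (a : nat -> R) : Prop :=
  exists (c1 c2 c3 c4 : Z) (b : nat -> R), inQ ns b /\
    forall k, a k = IZR c1 * gen ns 1 k + IZR c2 * gen ns 2 k
                    + IZR c3 * gen ns 3 k + IZR c4 * gen ns 4 k + b k.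

Definition blocks (m1 m2 m3 m4 eps : nat) (i : nat) : nat :=
  match i with
  | 1%nat => 8 * m1 + 4 * eps + 2
  | 2%nat => 8 * m2 + 4 * eps + 2
  | 3%nat => 8 * m3 + 4 * eps + 2
  | 4%nat => 8 * m4 + 4 * eps + 2
  | _ => 0
  end%nat.

(* Main.v *)
(* L is the union of sixteen cosets of Q = D_{n_1} + ... + D_{n_4}, one for each word of a
   self-dual code over the glue groups Z/2 x Z/2. The theta series of a coset is a product
   over the blocks of (theta_3^n + theta_4^n)/2, (theta_3^n - theta_4^n)/2 or theta_2^n/2;
   adding the sixteen products and writing a, b, c for theta_3, theta_4, theta_2 gives
   1/2 h - 1/8 sum (a1 a2 - b1 b2 - c1 c2) (a3 a4 - b3 b4 - c3 c4), where a1 = a^{n_1} etc.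
   The denominators of the rho_k cancel against Delta_24 even where a theta function might
   vanish, and rho_{-1} = 0 is the right convention, by Jacobi's identity
   theta_3^4 = theta_2^4 + theta_4^4, itself the equality of the theta series of two cosets
   of D_4 exchanged by triality. Integrality follows from evenness by polarisation, and a
   dual vector is recognised by pairing it with vectors e_k +- e_l and the generators. *)
From Stdlib Require Import Reals ZArith Lia Lra Psatz Bool.
From Stdlib Require Import Classical ClassicalEpsilon FunctionalExtensionality.
From Coquelicot Require Import Coquelicot.
From Stdlib Require Import List.
Require Import Defs.
Open Scope R_scope.

(** * Unconditional sums *)

(** Sums are limits of nets of finite partial sums and the theta functions are values picked by
    [epsilon], so every identity between series needs its own convergence proof. Factoring a sum
    over integer vectors into sums over single coordinates requires bounded absolute partial sums;
    [AbsSum] carries this bound until the product is formed, and all later regrouping uses [HasSum]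
    alone.

    The series over m of q^((m+1/2)^2) with sign (-1)^m vanishes. This is why the two half-integral
    cosets of D_n share the series theta_2^n/2.

    The congruence n_i = 2 mod 4 acts twice. As n_i is even, 2 x_1 lies in D_{n_i}, so only the
    parities of the glue coefficients matter. As n_i/4 = 2 m_i + eps + 1/2 with a common eps, two
    half-integral blocks contribute an odd norm modulo 2, which a word balances by exactly one block
    in the class of x_2.

    The factor 1/8 is 32/2^8, the 2^8 coming from the denominator in Delta_24. *)

Definition eqdec {T} (x y : T) : {x = y} + {x <> y} :=
  excluded_middle_informative (x = y).

Definition decb (P : Prop) : bool :=
  if excluded_middle_informative P then true else false.

Lemma decb_true (P : Prop) : decb P = true <-> P.
Proof. unfold decb; destruct excluded_middle_informative; split; congruence || tauto. Qed.

Definition sumlR {T} (f : T -> R) (G : list T) : R :=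
  fold_right (fun x acc => f x + acc) 0 G.

Definition union {T} (F G : list T) : list T := nodup eqdec (F ++ G).

Lemma union_NoDup {T} (F G : list T) : NoDup (union F G).
Proof. apply NoDup_nodup. Qed.

Lemma union_Forall {T} (A : T -> Prop) (F G : list T) :
  Forall A F -> Forall A G -> Forall A (union F G).
Proof.
  intros HF HG; rewrite Forall_forall in *; intros x Hx.
  apply nodup_In, in_app_iff in Hx; destruct Hx; auto.
Qed.

Lemma union_incl_l {T} (F G : list T) : incl F (union F G).
Proof. intros x Hx; apply nodup_In, in_app_iff; auto. Qed.

Lemma union_incl_r {T} (F G : list T) : incl G (union F G).
Proof. intros x Hx; apply nodup_In, in_app_iff; auto. Qed.

Lemma sumC_app {T} (f : T -> C) (F G : list T) :
  sumC f (F ++ G) = Cplus (sumC f F) (sumC f G).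
Proof. induction F as [|x F IH]; simpl; [ring|]. rewrite IH; ring. Qed.

Lemma sumC_ext {T} (f g : T -> C) (G : list T) :
  (forall x, In x G -> f x = g x) -> sumC f G = sumC g G.
Proof.
  induction G as [|x G IH]; simpl; intros H; [reflexivity|].
  rewrite H, IH; auto.
Qed.

Lemma sumC_lin {T} (a b : C) (f g : T -> C) (G : list T) :
  sumC (fun x => Cplus (Cmult a (f x)) (Cmult b (g x))) G
  = Cplus (Cmult a (sumC f G)) (Cmult b (sumC g G)).
Proof. induction G as [|x G IH]; simpl; [ring|]. rewrite IH; ring. Qed.

Lemma sumC_map {T U} (h : T -> U) (f : U -> C) (G : list T) :
  sumC f (map h G) = sumC (fun x => f (h x)) G.
Proof. induction G as [|x G IH]; simpl; [reflexivity|]. rewrite IH; reflexivity. Qed.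

Lemma sumC_filter {T} (p : T -> bool) (f : T -> C) (G : list T) :
  sumC f (filter p G) = sumC (fun x => if p x then f x else RtoC 0) G.
Proof.
  induction G as [|x G IH]; simpl; [reflexivity|].
  destruct (p x); simpl; rewrite IH; [reflexivity|ring].
Qed.

Lemma sumC_prod {T U} (f : T -> C) (g : U -> C) (F : list T) (G : list U) :
  sumC (fun x => Cmult (f (fst x)) (g (snd x))) (list_prod F G)
  = Cmult (sumC f F) (sumC g G).
Proof.
  induction F as [|x F IH]; simpl; [ring|].
  rewrite sumC_app, IH, sumC_map; simpl.
  replace (sumC (fun y => Cmult (f x) (g y)) G) with (Cmult (f x) (sumC g G)); [ring|].
  clear; induction G as [|y G IH]; simpl; [ring|]. rewrite <- IH; ring.
Qed.

Lemma sumlR_app {T} (f : T -> R) (F G : list T) :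
  sumlR f (F ++ G) = sumlR f F + sumlR f G.
Proof. induction F as [|x F IH]; simpl; [ring|]. rewrite IH; ring. Qed.

Lemma sumlR_prod {T U} (f : T -> R) (g : U -> R) (F : list T) (G : list U) :
  sumlR (fun x => f (fst x) * g (snd x)) (list_prod F G) = sumlR f F * sumlR g G.
Proof.
  induction F as [|x F IH]; simpl; [ring|].
  rewrite sumlR_app, IH; clear IH.
  replace (sumlR (fun x => f (fst x) * g (snd x)) (map (fun y => (x, y)) G))
    with (f x * sumlR g G); [ring|].
  induction G as [|y G IH]; simpl; [ring|]. rewrite <- IH; ring.
Qed.

Lemma sumlR_ge0 {T} (f : T -> R) (G : list T) :
  (forall x, In x G -> 0 <= f x) -> 0 <= sumlR f G.
Proof.
  induction G as [|x G IH]; simpl; intros H; [lra|].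
  assert (0 <= f x) by auto. assert (0 <= sumlR f G) by auto. lra.
Qed.

Lemma sumlR_le {T} (f g : T -> R) (G : list T) :
  (forall x, In x G -> f x <= g x) -> sumlR f G <= sumlR g G.
Proof.
  induction G as [|x G IH]; simpl; intros H; [lra|].
  assert (f x <= g x) by auto. assert (sumlR f G <= sumlR g G) by auto. lra.
Qed.

Lemma sumlR_incl {T} (f : T -> R) (F G : list T) :
  (forall x, In x G -> 0 <= f x) -> NoDup F -> incl F G -> sumlR f F <= sumlR f G.
Proof.
  intros H HF; revert G H; induction HF as [|x F Hx HF IH]; intros G H Hi.
  - apply sumlR_ge0; auto.
  - destruct (in_split x G) as (l1 & l2 & ->); [apply Hi; simpl; auto|].
    assert (sumlR f F <= sumlR f (l1 ++ l2)).
    { apply IH.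
      - intros y Hy; apply H; rewrite in_app_iff in *; simpl; tauto.
      - intros y Hy. assert (In y (l1 ++ x :: l2)) by (apply Hi; simpl; auto).
        rewrite in_app_iff in *; simpl in *.
        destruct H0 as [|[->|]]; tauto. }
    rewrite sumlR_app in *; simpl; lra.
Qed.

Lemma NoDup_list_prod {T U} (F : list T) (G : list U) :
  NoDup F -> NoDup G -> NoDup (list_prod F G).
Proof.
  intros HF HG; induction HF as [|x F Hx HF IH]; simpl; [constructor|].
  apply NoDup_app; auto.
  - apply NoDup_map_NoDup_ForallPairs; auto. intros a b _ _ E; congruence.
  - intros [a b] H1 H2. apply in_map_iff in H1 as (y & E & _).
    apply in_prod_iff in H2. inversion E; subst; tauto.
Qed.

Lemma Cmod_le_abs (w : C) : Cmod w <= Rabs (Re w) + Rabs (Im w).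
Proof.
  destruct w as [a b]; simpl.
  replace ((a, b) : C) with (Cplus (RtoC a) (Cmult Ci (RtoC b))).
  - eapply Rle_trans; [apply Cmod_triangle|].
    rewrite Cmod_mult, Cmod_Ci, !Cmod_R; lra.
  - apply injective_projections; simpl; ring.
Qed.

Lemma HasSum_unique {T} (A : T -> Prop) (f : T -> C) (S S' : C) :
  HasSum A f S -> HasSum A f S' -> S = S'.
Proof.
  intros H H'. destruct (eqdec S S') as [|N]; [assumption|exfalso].
  assert (P : 0 < Cmod (Cminus S S')).
  { apply Cmod_gt_0; intros E; apply N.
    replace S with (Cplus (Cminus S S') S') by ring. rewrite E; ring. }
  destruct (H (Cmod (Cminus S S') / 2)) as (F & F1 & F2 & F3); [lra|].
  destruct (H' (Cmod (Cminus S S') / 2)) as (F' & F1' & F2' & F3'); [lra|].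
  specialize (F3 (union F F') (union_NoDup _ _) (union_Forall _ _ _ F2 F2') (union_incl_l _ _)).
  specialize (F3' (union F F') (union_NoDup _ _) (union_Forall _ _ _ F2 F2') (union_incl_r _ _)).
  set (s := sumC f (union F F')) in *.
  assert (Cmod (Cminus S S') <= Cmod (Cminus s S) + Cmod (Cminus s S')); [|lra].
  rewrite <- (Cmod_opp (Cminus s S)).
  replace (Cminus S S') with (Cplus (Copp (Cminus s S)) (Cminus s S')) by ring.
  apply Cmod_triangle.
Qed.

Lemma HasSum_ext {T} (A B : T -> Prop) (f g : T -> C) (S : C) :
  (forall x, A x <-> B x) -> (forall x, A x -> f x = g x) ->
  HasSum A f S -> HasSum B g S.
Proof.
  intros HAB Hfg H eps He. destruct (H eps He) as (F & F1 & F2 & F3).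
  exists F; split; [assumption|]; split.
  - eapply Forall_impl; [|exact F2]. intros x; apply HAB.
  - intros G G1 G2 G3.
    assert (G2' : Forall A G) by (eapply Forall_impl; [|exact G2]; intros x; apply HAB).
    rewrite <- (sumC_ext f g); auto.
    intros x Hx; apply Hfg. rewrite Forall_forall in G2'; auto.
Qed.

Lemma HasSum_lin {T} (A : T -> Prop) (a b : C) (f g : T -> C) (S S' : C) :
  HasSum A f S -> HasSum A g S' ->
  HasSum A (fun x => Cplus (Cmult a (f x)) (Cmult b (g x)))
    (Cplus (Cmult a S) (Cmult b S')).
Proof.
  intros H H' eps He.
  set (M := 1 + Cmod a + Cmod b).
  assert (HM : 0 < M) by (unfold M; pose proof (Cmod_ge_0 a); pose proof (Cmod_ge_0 b); lra).
  assert (Hd : eps / M > 0) by (apply Rdiv_lt_0_compat; lra).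
  destruct (H _ Hd) as (F & F1 & F2 & F3).
  destruct (H' _ Hd) as (F' & F1' & F2' & F3').
  exists (union F F'); split; [apply union_NoDup|]; split; [apply union_Forall; auto|].
  intros G G1 G2 G3.
  specialize (F3 G G1 G2 (incl_tran (union_incl_l _ _) G3)).
  specialize (F3' G G1 G2 (incl_tran (union_incl_r _ _) G3)).
  rewrite sumC_lin.
  replace (Cminus _ _) with
    (Cplus (Cmult a (Cminus (sumC f G) S)) (Cmult b (Cminus (sumC g G) S'))) by ring.
  eapply Rle_lt_trans; [apply Cmod_triangle|]. rewrite !Cmod_mult.
  replace eps with (M * (eps / M)) by (field; lra).
  unfold M at 1. pose proof (Cmod_ge_0 a); pose proof (Cmod_ge_0 b). nra.
Qed.

Lemma Forall_image_map {T U} (A : T -> Prop) (h : T -> U) (G : list U) :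
  Forall (fun y => exists x, A x /\ y = h x) G -> exists G', Forall A G' /\ G = map h G'.
Proof.
  intros H. induction H as [|y G (x & Hx & ->) _ (G' & HG' & ->)].
  - exists nil; auto.
  - exists (x :: G'); auto.
Qed.

(** Reindexing along an injection. It carries sums through the reflection of Z, the Hadamard map and
    the parametrisation of cosets by integer vectors. *)
Lemma HasSum_image {T U} (A : T -> Prop) (h : T -> U) (f : U -> C) (S : C) :
  (forall x y, A x -> A y -> h x = h y -> x = y) ->
  HasSum A (fun x => f (h x)) S ->
  HasSum (fun y => exists x, A x /\ y = h x) f S.
Proof.
  intros Hinj H eps He. destruct (H eps He) as (F & F1 & F2 & F3).
  rewrite Forall_forall in F2.
  exists (map h F); split; [|split].
  - apply NoDup_map_NoDup_ForallPairs; auto. intros x y Hx Hy; auto.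
  - apply Forall_forall; intros y Hy. apply in_map_iff in Hy as (x & <- & Hx). eauto.
  - intros G G1 G2 G3.
    destruct (Forall_image_map _ _ _ G2) as (G' & HG' & ->).
    rewrite sumC_map. apply F3; auto.
    + eapply NoDup_map_inv; eauto.
    + intros x Hx. assert (Hy : In (h x) (map h G')) by (apply G3, in_map; auto).
      apply in_map_iff in Hy as (x' & E & Hx').
      rewrite Forall_forall in HG'. apply Hinj in E; auto; congruence.
Qed.

Lemma HasSum_restrict {T} (A : T -> Prop) (p : T -> bool) (f : T -> C) (S : C) :
  HasSum A (fun x => if p x then f x else RtoC 0) S ->
  HasSum (fun x => A x /\ p x = true) f S.
Proof.
  intros H eps He. destruct (H eps He) as (F & F1 & F2 & F3).
  rewrite Forall_forall in F2.
  exists (filter p F); split; [apply NoDup_filter; auto|]; split.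
  - apply Forall_forall; intros x Hx; apply filter_In in Hx as []; auto.
  - intros G G1 G2 G3. rewrite Forall_forall in G2.
    (* [G] contains only the part of [F] where [p] holds. Adjoining the rest of [F] adds zeros and
       makes the hypothesis on [F] applicable. *)
    set (G' := G ++ filter (fun x => negb (p x)) F).
    replace (sumC f G) with (sumC (fun x => if p x then f x else RtoC 0) G').
    + apply F3.
      * apply NoDup_app; auto using NoDup_filter.
        intros x Hx Hx'. apply filter_In in Hx' as [_ Hx'].
        apply G2 in Hx as [_ Hx]. rewrite Hx in Hx'; discriminate.
      * apply Forall_app; split; apply Forall_forall.
        -- intros x Hx; apply G2; auto.
        -- intros x Hx; apply filter_In in Hx as []; auto.
      * intros x Hx. apply in_app_iff. rewrite filter_In.
        destruct (p x) eqn:E; [left; apply G3, filter_In; auto|right; auto].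
    + unfold G'. rewrite <- sumC_filter, filter_app, sumC_app.
      replace (filter p G) with G.
      2: { symmetry; apply forallb_filter_id, forallb_forall. intros x Hx; apply G2; auto. }
      replace (sumC f (filter p _)) with (RtoC 0); [ring|].
      clear. induction F as [|x F IH]; simpl; auto.
      destruct (p x) eqn:E; simpl; auto. rewrite E; auto.
Qed.

Lemma HasSum_extend {T} (A : T -> Prop) (p : T -> bool) (f : T -> C) (S : C) :
  HasSum (fun x => A x /\ p x = true) f S ->
  HasSum A (fun x => if p x then f x else RtoC 0) S.
Proof.
  intros H eps He. destruct (H eps He) as (F & F1 & F2 & F3).
  exists F; split; [assumption|]; split.
  - eapply Forall_impl; [|exact F2]. intros x []; auto.
  - intros G G1 G2 G3. rewrite <- sumC_filter. rewrite Forall_forall in *.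
    apply F3.
    + apply NoDup_filter; auto.
    + apply Forall_forall; intros x Hx; apply filter_In in Hx as []; auto.
    + intros x Hx; apply filter_In; split; auto. apply F2; auto.
Qed.

(** Extended by zero to the union, both families have the same index set and can be added by
    linearity. *)
Lemma HasSum_disjoint_union {T} (A B : T -> Prop) (f : T -> C) (S S' : C) :
  (forall x, A x -> B x -> False) ->
  HasSum A f S -> HasSum B f S' ->
  HasSum (fun x => A x \/ B x) f (Cplus S S').
Proof.
  intros Hd HA HB.
  assert (E : forall (D : T -> Prop) s, (forall x, D x -> A x \/ B x) -> HasSum D f s ->
    HasSum (fun x => A x \/ B x) (fun x => if decb (D x) then f x else RtoC 0) s).
  { intros D s HD Hs. apply HasSum_extend.
    apply (HasSum_ext D _ f f) with (3 := Hs); auto.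
    intros x; rewrite decb_true; specialize (HD x); tauto. }
  apply E in HA; [|tauto]. apply E in HB; [|tauto].
  pose proof (HasSum_lin _ (RtoC 1) (RtoC 1) _ _ _ _ HA HB) as H.
  rewrite !Cmult_1_l in H.
  revert H; apply HasSum_ext; [tauto|].
  intros x Hx. rewrite !Cmult_1_l.
  unfold decb; repeat destruct excluded_middle_informative.
  - exfalso; eauto.
  - ring.
  - ring.
  - tauto.
Qed.

Lemma HasSum_bool {T} (A : bool -> T -> Prop) (f : T -> C) (S : bool -> C) :
  (forall x b b', A b x -> A b' x -> b = b') ->
  (forall b, HasSum (A b) f (S b)) ->
  HasSum (fun x => exists b, A b x) f (Cplus (S true) (S false)).
Proof.
  intros Hd H.
  apply (HasSum_ext (fun x => A true x \/ A false x) _ f f); auto.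
  - intros x; split; [intros []; eauto|]. intros [[] ?]; auto.
  - apply HasSum_disjoint_union; auto.
    intros x H1 H2. specialize (Hd _ _ _ H1 H2); discriminate.
Qed.

(** * Convergence from bounded absolute partial sums *)

Definition bounded_abs {T} (A : T -> Prop) (f : T -> C) (M : R) : Prop :=
  forall G, NoDup G -> Forall A G -> sumlR (fun x => Cmod (f x)) G <= M.

Lemma real_net_converges {T} (A : T -> Prop) (f : T -> R) (M : R) :
  (forall x, 0 <= f x) ->
  (forall G, NoDup G -> Forall A G -> sumlR f G <= M) ->
  exists s, forall eps, eps > 0 ->
    exists F, NoDup F /\ Forall A F /\
      forall G, NoDup G -> Forall A G -> incl F G -> Rabs (sumlR f G - s) < eps.
Proof.
  intros Hf HM.
  destruct (completeness (fun y => exists G, NoDup G /\ Forall A G /\ y = sumlR f G))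
    as (s & Hs1 & Hs2).
  - exists M; intros y (G & G1 & G2 & ->); auto.
  - exists 0, nil; repeat split; constructor.
  - exists s; intros eps He.
    assert (HF : exists F, NoDup F /\ Forall A F /\ s - eps < sumlR f F).
    { apply NNPP; intros N.
      enough (s <= s - eps) by lra. apply Hs2.
      intros y (G & G1 & G2 & ->). apply Rnot_lt_le; intros L; apply N; eauto. }
    destruct HF as (F & F1 & F2 & F3).
    exists F; split; [assumption|]; split; [assumption|].
    intros G G1 G2 G3.
    assert (sumlR f F <= sumlR f G) by (apply sumlR_incl; auto).
    assert (sumlR f G <= s) by (apply Hs1; eauto).
    apply Rabs_def1; lra.
Qed.

(** Real and imaginary parts are differences of nonnegative families, Re f = (|f| + Re f) - |f|,
    each bounded by 2|f|, so suprema of partial sums give the limits. *)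
Lemma HasSum_exists {T} (A : T -> Prop) (f : T -> C) (M : R) :
  bounded_abs A f M -> exists S, HasSum A f S.
Proof.
  intros HM.
  assert (B : forall g : T -> R, (forall x, 0 <= g x <= 2 * Cmod (f x)) ->
    exists s, forall eps, eps > 0 ->
    exists F, NoDup F /\ Forall A F /\
      forall G, NoDup G -> Forall A G -> incl F G -> Rabs (sumlR g G - s) < eps).
  { intros g Hg. apply real_net_converges with (M := 2 * M); [apply Hg|].
    intros G G1 G2. apply Rle_trans with (2 * sumlR (fun x => Cmod (f x)) G).
    - clear -Hg. induction G as [|x G IH]; simpl; [lra|]. specialize (Hg x); lra.
    - specialize (HM G G1 G2); lra. }
  pose proof (fun x => Cmod_ge_0 (f x)) as P0.
  assert (P1 : forall x, Rabs (Re (f x)) <= Cmod (f x)) by (intros; apply re_le_Cmod).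
  assert (P2 : forall x, Rabs (Im (f x)) <= Cmod (f x)) by (intros; eapply Rle_trans; [apply Rmax_r|apply Rmax_Cmod]).
  destruct (B (fun x => Cmod (f x))) as (s0 & H0); [intros x; specialize (P0 x); lra|].
  destruct (B (fun x => Cmod (f x) + Re (f x))) as (s1 & H1).
  { intros x; specialize (P1 x). apply Rabs_le_between in P1; lra. }
  destruct (B (fun x => Cmod (f x) + Im (f x))) as (s2 & H2).
  { intros x; specialize (P2 x). apply Rabs_le_between in P2; lra. }
  exists (s1 - s0, s2 - s0); intros eps He.
  destruct (H0 (eps / 4)) as (F0 & F01 & F02 & F03); [lra|].
  destruct (H1 (eps / 4)) as (F1 & F11 & F12 & F13); [lra|].
  destruct (H2 (eps / 4)) as (F2 & F21 & F22 & F23); [lra|].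
  exists (union F0 (union F1 F2)).
  split; [apply union_NoDup|]; split; [repeat apply union_Forall; auto|].
  intros G G1 G2 G3.
  assert (I0 : incl F0 G) by (eapply incl_tran; [apply union_incl_l|exact G3]).
  assert (I12 : incl (union F1 F2) G) by (eapply incl_tran; [apply union_incl_r|exact G3]).
  specialize (F03 G G1 G2 I0).
  specialize (F13 G G1 G2 (incl_tran (union_incl_l _ _) I12)).
  specialize (F23 G G1 G2 (incl_tran (union_incl_r _ _) I12)).
  eapply Rle_lt_trans; [apply Cmod_le_abs|].
  assert (E1 : Re (sumC f G) = sumlR (fun x => Cmod (f x) + Re (f x)) G - sumlR (fun x => Cmod (f x)) G).
  { clear. induction G as [|x G IH]; simpl; [ring|]. fold (Re (f x)) (Re (sumC f G)); rewrite IH; ring. }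
  assert (E2 : Im (sumC f G) = sumlR (fun x => Cmod (f x) + Im (f x)) G - sumlR (fun x => Cmod (f x)) G).
  { clear. induction G as [|x G IH]; simpl; [ring|]. fold (Im (f x)) (Im (sumC f G)); rewrite IH; ring. }
  replace (Re (Cminus (sumC f G) (s1 - s0, s2 - s0))) with (Re (sumC f G) - (s1 - s0)) by reflexivity.
  replace (Im (Cminus (sumC f G) (s1 - s0, s2 - s0))) with (Im (sumC f G) - (s2 - s0)) by reflexivity.
  rewrite E1, E2.
  apply Rabs_def2 in F03, F13, F23.
  set (a := sumlR (fun x => Cmod (f x)) G) in *.
  set (b := sumlR (fun x => Cmod (f x) + Re (f x)) G) in *.
  set (c := sumlR (fun x => Cmod (f x) + Im (f x)) G) in *.
  assert (Rabs (b - a - (s1 - s0)) < eps / 2) by (apply Rabs_def1; lra).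
  assert (Rabs (c - a - (s2 - s0)) < eps / 2) by (apply Rabs_def1; lra).
  lra.
Qed.

Definition AbsSum {T} (A : T -> Prop) (f : T -> C) (S : C) : Prop :=
  HasSum A f S /\ exists M, bounded_abs A f M.

Lemma AbsSum_ext {T} (A B : T -> Prop) (f g : T -> C) (S : C) :
  (forall x, A x <-> B x) -> (forall x, A x -> f x = g x) ->
  AbsSum A f S -> AbsSum B g S.
Proof.
  intros HAB Hfg [H [M HM]]; split; [eapply HasSum_ext; eauto|].
  exists M; intros G G1 G2.
  assert (G2' : Forall A G) by (eapply Forall_impl; [|exact G2]; intros x; apply HAB).
  eapply Rle_trans; [|apply (HM G); auto].
  apply sumlR_le. intros x Hx. rewrite Hfg; [lra|]. rewrite Forall_forall in G2'; auto.
Qed.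

Lemma AbsSum_image {T U} (A : T -> Prop) (h : T -> U) (f : U -> C) (S : C) :
  (forall x y, A x -> A y -> h x = h y -> x = y) ->
  AbsSum A (fun x => f (h x)) S ->
  AbsSum (fun y => exists x, A x /\ y = h x) f S.
Proof.
  intros Hinj [H [M HM]]; split; [apply HasSum_image; auto|].
  exists M; intros G G1 G2.
  destruct (Forall_image_map _ _ _ G2) as (G' & HG' & ->).
  eapply Rle_trans; [|apply (HM G'); eauto using NoDup_map_inv].
  right. clear. induction G' as [|x G IH]; simpl; congruence.
Qed.

(* The product family is summable because its absolute partial sums are bounded;
   its sum is then found along the product lists. *)
Lemma AbsSum_prod {T U} (A : T -> Prop) (B : U -> Prop) (f : T -> C) (g : U -> C) (S S' : C) :
  AbsSum A f S -> AbsSum B g S' ->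
  AbsSum (fun x => A (fst x) /\ B (snd x)) (fun x => Cmult (f (fst x)) (g (snd x)))
    (Cmult S S').
Proof.
  intros [HA [M HM]] [HB [M' HM']].
  assert (BD : bounded_abs (fun x => A (fst x) /\ B (snd x))
                 (fun x => Cmult (f (fst x)) (g (snd x))) (M * M')).
  { intros G G1 G2. rewrite Forall_forall in G2.
    (* A finite set of pairs lies in the product of its two projections, over which the absolute sum
       factors. *)
    set (F1 := nodup eqdec (map fst G)). set (F2 := nodup eqdec (map snd G)).
    assert (D1 : Forall A F1).
    { apply Forall_forall; intros x Hx. apply nodup_In, in_map_iff in Hx as (y & <- & Hy).
      apply G2; auto. }
    assert (D2 : Forall B F2).
    { apply Forall_forall; intros x Hx. apply nodup_In, in_map_iff in Hx as (y & <- & Hy).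
      apply G2; auto. }
    apply Rle_trans with (sumlR (fun x => Cmod (f (fst x)) * Cmod (g (snd x))) (list_prod F1 F2)).
    - eapply Rle_trans;
        [|apply sumlR_incl with (F := G)].
      + apply sumlR_le. intros x _. rewrite Cmod_mult; lra.
      + intros x _. apply Rmult_le_pos; apply Cmod_ge_0.
      + assumption.
      + intros [x y] Hx. apply in_prod_iff; split; apply nodup_In.
        * apply (in_map fst) in Hx; exact Hx.
        * apply (in_map snd) in Hx; exact Hx.
    - rewrite (sumlR_prod (fun x => Cmod (f x)) (fun y => Cmod (g y))).
      apply Rmult_le_compat.
      + apply sumlR_ge0; intros; apply Cmod_ge_0.
      + apply sumlR_ge0; intros; apply Cmod_ge_0.
      + apply HM; auto. apply NoDup_nodup.
      + apply HM'; auto. apply NoDup_nodup. }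
  split; [|eauto].
  destruct (HasSum_exists _ _ _ BD) as [P HP].
  replace (Cmult S S') with P; [assumption|].
  destruct (eqdec P (Cmult S S')) as [|N]; [assumption|exfalso].
  set (e := Cmod (Cminus P (Cmult S S'))).
  assert (He : 0 < e).
  { apply Cmod_gt_0; intros E; apply N.
    replace P with (Cplus (Cminus P (Cmult S S')) (Cmult S S')) by ring. rewrite E; ring. }
  (* With both factors within [d] of their limits and [d <= 1], the product is off by at most d +
     |S| d + |S'| d = d K, which must not exceed [e / 2]. *)
  set (K := Cmod S + Cmod S' + 1).
  assert (HK : K >= 1) by (unfold K; pose proof (Cmod_ge_0 S); pose proof (Cmod_ge_0 S'); lra).
  set (d := Rmin 1 (e / 2 / K)).
  assert (Hd : d > 0).
  { apply Rmin_pos; [lra|]. apply Rdiv_lt_0_compat; lra. }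
  assert (Hd1 : d <= 1) by apply Rmin_l.
  assert (HdK : d * K <= e / 2).
  { apply Rle_trans with (e / 2 / K * K); [|right; field; lra].
    apply Rmult_le_compat_r; [lra|apply Rmin_r]. }
  destruct (HA d Hd) as (F1 & F11 & F12 & F13).
  destruct (HB d Hd) as (F2 & F21 & F22 & F23).
  destruct (HP (e / 2)) as (F & FF1 & FF2 & FF3); [lra|].
  rewrite Forall_forall in FF2.
  (* Adjoining the projections of [F] makes the product list contain [F], so the net over pairs is
     also close to [P] there. *)
  set (G1 := union F1 (map fst F)). set (G2 := union F2 (map snd F)).
  assert (D1 : Forall A G1).
  { apply union_Forall; auto. apply Forall_forall; intros x Hx.
    apply in_map_iff in Hx as (y & <- & Hy). apply FF2; auto. }
  assert (D2 : Forall B G2).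
  { apply union_Forall; auto. apply Forall_forall; intros x Hx.
    apply in_map_iff in Hx as (y & <- & Hy). apply FF2; auto. }
  specialize (F13 G1 (union_NoDup _ _) D1 (union_incl_l _ _)).
  specialize (F23 G2 (union_NoDup _ _) D2 (union_incl_l _ _)).
  assert (L : Cmod (Cminus (Cmult (sumC f G1) (sumC g G2)) P) < e / 2).
  { rewrite <- sumC_prod. apply FF3.
    - apply NoDup_list_prod; apply union_NoDup.
    - apply Forall_forall; intros [x y] Hx. apply in_prod_iff in Hx.
      rewrite Forall_forall in D1, D2. split; [apply D1|apply D2]; tauto.
    - intros [x y] Hx. apply in_prod_iff; split; apply union_incl_r.
      + apply (in_map fst) in Hx; exact Hx.
      + apply (in_map snd) in Hx; exact Hx. }
  set (x := sumC f G1) in *. set (y := sumC g G2) in *.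
  assert (E : e <= Cmod (Cminus (Cmult x y) P)
     + (Cmod (Cminus x S) * Cmod (Cminus y S') + Cmod S * Cmod (Cminus y S')
        + Cmod S' * Cmod (Cminus x S))).
  { unfold e. rewrite <- (Cmod_opp (Cminus (Cmult x y) P)), <- !Cmod_mult.
    replace (Cminus P (Cmult S S')) with
      (Cplus (Copp (Cminus (Cmult x y) P))
        (Cplus (Cplus (Cmult (Cminus x S) (Cminus y S')) (Cmult S (Cminus y S')))
           (Cmult S' (Cminus x S)))) by ring.
    eapply Rle_trans; [apply Cmod_triangle|]. apply Rplus_le_compat_l.
    eapply Rle_trans; [apply Cmod_triangle|]. apply Rplus_le_compat_r.
    apply Cmod_triangle. }
  pose proof (Cmod_ge_0 S); pose proof (Cmod_ge_0 S').
  pose proof (Cmod_ge_0 (Cminus x S)); pose proof (Cmod_ge_0 (Cminus y S')).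
  assert (Cmod (Cminus x S) * Cmod (Cminus y S') <= d * 1) by (apply Rmult_le_compat; lra).
  assert (Cmod S * Cmod (Cminus y S') <= Cmod S * d) by (apply Rmult_le_compat_l; lra).
  assert (Cmod S' * Cmod (Cminus x S) <= Cmod S' * d) by (apply Rmult_le_compat_l; lra).
  unfold K in HdK. nra.
Qed.

(** * Theta functions and sums over integer vectors *)

Lemma AbsSum_singleton {T} (a : T) (f : T -> C) : AbsSum (fun x => x = a) f (f a).
Proof.
  assert (E : forall G, NoDup G -> Forall (fun x => x = a) G -> G = nil \/ G = a :: nil).
  { intros [|x [|y G]] H1 H2; auto; rewrite Forall_forall in H2.
    - right; f_equal; apply H2; simpl; auto.
    - exfalso. inversion H1; subst. apply H3.
      rewrite (H2 x), (H2 y); simpl; auto. }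
  split.
  - intros eps He. exists (a :: nil); split; [repeat constructor; auto|]; split; [auto|].
    intros G G1 G2 G3. destruct (E G G1 G2) as [->| ->].
    + destruct (G3 a); simpl; auto.
    + simpl. replace (Cminus _ _) with (RtoC 0) by ring. rewrite Cmod_0; lra.
  - exists (Cmod (f a)); intros G G1 G2. destruct (E G G1 G2) as [->| ->]; simpl.
    + apply Cmod_ge_0.
    + lra.
Qed.

Lemma Cexp_plus (v w : C) : Cexp (Cplus v w) = Cmult (Cexp v) (Cexp w).
Proof.
  destruct v as [a b], w as [c d]; unfold Cexp; simpl.
  rewrite exp_plus, cos_plus, sin_plus.
  apply injective_projections; simpl; ring.
Qed.

Lemma Cmod_Cexp (w : C) : Cmod (Cexp w) = exp (Re w).
Proof.
  unfold Cexp, Cmod; simpl.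
  replace (_ + _) with ((exp (Re w))²).
  - apply sqrt_Rsqr, Rlt_le, exp_pos.
  - transitivity ((exp (Re w))² * ((sin (Im w))² + (cos (Im w))²)).
    + rewrite sin2_cos2; ring.
    + unfold Rsqr; ring.
Qed.

Lemma qpow_plus (z : C) (x y : R) : qpow z (x + y) = Cmult (qpow z x) (qpow z y).
Proof.
  unfold qpow. rewrite <- Cexp_plus. f_equal.
  rewrite Rmult_plus_distr_l, RtoC_plus. ring.
Qed.

Lemma qpow_0 (z : C) : qpow z 0 = RtoC 1.
Proof.
  unfold qpow. rewrite Rmult_0_r, Cmult_0_l. unfold Cexp; simpl.
  rewrite exp_0, cos_0, sin_0. apply injective_projections; simpl; ring.
Qed.

Lemma Cmod_qpow (z : C) (x : R) : Cmod (qpow z x) = exp (- (PI * Im z) * x).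
Proof.
  unfold qpow. rewrite Cmod_Cexp. f_equal. destruct z as [a b]; simpl; ring.
Qed.

Lemma Cpow_Defs (w : C) (k : nat) : Defs.Cpow w k = Complex.Cpow w k.
Proof. induction k as [|k IH]; simpl; [reflexivity|]. rewrite IH; reflexivity. Qed.

Lemma Cpow_qn (z : C) (k : nat) : Complex.Cpow (qn z) k = qpow z (INR k).
Proof.
  induction k as [|k IH]; [symmetry; apply qpow_0|].
  rewrite S_INR, Rplus_comm, qpow_plus, <- IH. simpl. f_equal.
  unfold qn, qpow. rewrite Rmult_1_r; reflexivity.
Qed.

Definition sg (b : bool) (m : Z) : C := if b && Z.odd m then RtoC (-1) else RtoC 1.

Lemma sg_plus (b : bool) (m m' : Z) : sg b (m + m') = Cmult (sg b m) (sg b m').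
Proof.
  unfold sg. rewrite Z.odd_add.
  destruct b, (Z.odd m), (Z.odd m'); simpl;
    apply injective_projections; simpl; ring.
Qed.

Lemma Cmod_sg (b : bool) (m : Z) : Cmod (sg b m) = 1.
Proof. unfold sg; destruct (b && Z.odd m); rewrite Cmod_R; unfold Rabs; destruct Rcase_abs; lra. Qed.

Definition hf (p : bool) : R := if p then / 2 else 0.

(** Theta constants with half-integer characteristics: the flags (true, false), (false, false),
    (false, true) give theta_2, theta_3, theta_4. *)
Definition theta_term (z : C) (p b : bool) (m : Z) : C :=
  Cmult (sg b m) (qpow z ((IZR m + hf p) ^ 2)).

Definition theta (z : C) (p b : bool) : C := tsumZ (theta_term z p b).

Lemma sumlR_pow_seq (r : R) (N : nat) :
  0 < r < 1 -> sumlR (fun k => r ^ k) (seq 0 N) = (1 - r ^ N) / (1 - r).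
Proof.
  intros Hr. induction N as [|N IH].
  - simpl. field; lra.
  - rewrite seq_S, sumlR_app, IH; simpl. field; lra.
Qed.

Lemma sumlR_pow_abs (r : R) (G : list Z) :
  0 < r < 1 -> NoDup G -> sumlR (fun m => r ^ Z.abs_nat m) G <= 2 / (1 - r).
Proof.
  intros Hr HG.
  assert (HN : exists N, forall m, In m G -> (Z.abs_nat m < N)%nat).
  { clear HG. induction G as [|m G (N & HN)].
    - exists 0%nat; simpl; tauto.
    - exists (Nat.max N (S (Z.abs_nat m))). intros m' [<-|Hm']; [lia|]. specialize (HN _ Hm'); lia. }
  destruct HN as (N & HN).
  (* Each absolute value belongs to at most two integers. The value 0 is listed twice, which is
     harmless in an upper bound. *)
  apply Rle_trans with (sumlR (fun m => r ^ Z.abs_nat m)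
    (map Z.of_nat (seq 0 N) ++ map (fun k => (- Z.of_nat k)%Z) (seq 0 N))).
  - apply sumlR_incl; auto.
    + intros m _; apply pow_le; lra.
    + intros m Hm. specialize (HN m Hm). apply in_app_iff.
      destruct (Z.le_gt_cases 0 m); [left|right]; apply in_map_iff;
        exists (Z.abs_nat m); (split; [lia|apply in_seq; lia]).
  - assert (E : forall h : nat -> Z, (forall k, Z.abs_nat (h k) = k) -> forall l,
      sumlR (fun m => r ^ Z.abs_nat m) (map h l) = sumlR (fun k => r ^ k) l).
    { intros h Hh l; induction l as [|k l IH]; simpl; auto. rewrite Hh, IH; auto. }
    rewrite sumlR_app, !E by (intros; lia). rewrite sumlR_pow_seq by assumption.
    assert (0 < r ^ N) by (apply pow_lt; lra).
    replace (2 / (1 - r)) with ((1 - r ^ N) / (1 - r) + (1 - r ^ N) / (1 - r) + 2 * (r ^ N / (1 - r))) by (field; lra).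
    assert (0 < r ^ N / (1 - r)) by (apply Rdiv_lt_0_compat; lra). lra.
Qed.

Lemma exp_mult_INR (c : R) (k : nat) : exp (c * INR k) = exp c ^ k.
Proof.
  induction k as [|k IH].
  - simpl. rewrite Rmult_0_r; apply exp_0.
  - rewrite S_INR, Rmult_plus_distr_l, Rmult_1_r, exp_plus, IH; simpl; ring.
Qed.

(** A linear lower bound for the exponent compares the theta series with a geometric one. The -1 is
    forced by m = -1 with shift 1/2, and reappears as the factor [exp c] in the bound. *)
Lemma half_shift_square_ge (p : bool) (m : Z) : INR (Z.abs_nat m) - 1 <= (IZR m + hf p) ^ 2.
Proof.
  rewrite INR_IZR_INZ, Zabs2Nat.id_abs.
  assert (H : IZR (Z.abs m) - 1 <= IZR (m * m) /\ IZR (Z.abs m) - 1 <= IZR (m * m + m)).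
  { split; rewrite <- minus_IZR; apply IZR_le; nia. }
  rewrite plus_IZR, mult_IZR in H. unfold hf; destruct p; simpl; nra.
Qed.

Lemma theta_term_bounded (z : C) (p b : bool) :
  Im z > 0 -> exists M, bounded_abs (fun _ : Z => True) (theta_term z p b) M.
Proof.
  intros Hz. set (c := PI * Im z).
  assert (Hc : 0 < c) by (apply Rmult_lt_0_compat; [apply PI_RGT_0|assumption]).
  set (r := exp (- c)).
  assert (Hr : 0 < r < 1).
  { split; [apply exp_pos|]. rewrite <- exp_0. apply exp_increasing; lra. }
  exists (exp c * (2 / (1 - r))). intros G HG _.
  apply Rle_trans with (exp c * sumlR (fun m => r ^ Z.abs_nat m) G).
  - clear HG. induction G as [|m G IH]; simpl; [lra|].
    enough (Cmod (theta_term z p b m) <= exp c * r ^ Z.abs_nat m) by lra.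
    unfold theta_term. rewrite Cmod_mult, Cmod_sg, Cmod_qpow, Rmult_1_l.
    unfold r. rewrite <- exp_mult_INR, <- exp_plus. fold c.
    pose proof (half_shift_square_ge p m) as H.
    assert (E : - c * (IZR m + hf p) ^ 2 <= c + - c * INR (Z.abs_nat m)) by nra.
    destruct E as [E|E]; [left; apply exp_increasing; exact E|right; f_equal; exact E].
  - apply Rmult_le_compat_l; [apply Rlt_le, exp_pos|]. apply sumlR_pow_abs; assumption.
Qed.

(** This is what gives the value chosen by [epsilon] its meaning: in the upper half-plane a sum
    exists, so the choice is a sum. *)
Lemma theta_AbsSum (z : C) (p b : bool) :
  Im z > 0 -> AbsSum (fun _ : Z => True) (theta_term z p b) (theta z p b).
Proof.
  intros Hz. destruct (theta_term_bounded z p b Hz) as [M HM].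
  split; [|eauto]. unfold theta, tsumZ. apply epsilon_spec.
  eapply HasSum_exists; eauto.
Qed.

Lemma INR_square (m : Z) : INR (Z.to_nat (m * m)) = (IZR m) ^ 2.
Proof. rewrite INR_IZR_INZ, Z2Nat.id by nia. rewrite mult_IZR; ring. Qed.

Lemma theta2_eq (z : C) : theta2 z = theta z true false.
Proof.
  unfold theta2, theta. f_equal. apply functional_extensionality; intros m.
  unfold theta_term, sg, hf; simpl. ring.
Qed.

Lemma theta3_eq (z : C) : theta3 z = theta z false false.
Proof.
  unfold theta3, theta. f_equal. apply functional_extensionality; intros m.
  rewrite Cpow_Defs, Cpow_qn, INR_square.
  unfold theta_term, sg, hf; simpl. rewrite Rplus_0_r. ring.
Qed.

Lemma Cpow_opp (w : C) (k : nat) :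
  Complex.Cpow (Copp w) k = Cmult (sg true (Z.of_nat k)) (Complex.Cpow w k).
Proof.
  induction k as [|k IH].
  - unfold sg; simpl; ring.
  - rewrite Nat2Z.inj_succ, <- Z.add_1_r, sg_plus. simpl Complex.Cpow. rewrite IH.
    replace (sg true 1) with (RtoC (-1)) by reflexivity.
    replace (RtoC (-1)) with (Copp (RtoC 1)) by (apply injective_projections; simpl; ring). ring.
Qed.

Lemma theta4_eq (z : C) : theta4 z = theta z false true.
Proof.
  unfold theta4, theta. f_equal. apply functional_extensionality; intros m.
  rewrite Cpow_Defs, Cpow_opp, Cpow_qn, INR_square.
  unfold theta_term, hf. rewrite Rplus_0_r. f_equal.
  (* The sign is (-1)^(m^2), and m^2 has the parity of m. *)
  rewrite Z2Nat.id by nia. unfold sg. rewrite Z.odd_mul. destruct (Z.odd m); reflexivity.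
Qed.

(* The reflection m -> -1 - m preserves (m + 1/2)^2 and reverses the sign. *)
Lemma theta_half_sign (z : C) : Im z > 0 -> theta z true true = RtoC 0.
Proof.
  intros Hz. pose proof (proj1 (theta_AbsSum z true true Hz)) as H.
  assert (H' : HasSum (fun _ : Z => True) (fun m => theta_term z true true (-1 - m)) (Copp (theta z true true))).
  { pose proof (HasSum_lin _ (RtoC (-1)) (RtoC 0) _ _ _ _ H H) as H2.
    replace (Copp (theta z true true)) with (Cplus (Cmult (RtoC (-1)) (theta z true true)) (Cmult (RtoC 0) (theta z true true))) by (apply injective_projections; simpl; ring).
    revert H2; apply HasSum_ext; [tauto|]. intros m _. unfold theta_term.
    replace (hf true) with (/ 2) by reflexivity.
    replace ((IZR (-1 - m) + / 2) ^ 2) with ((IZR m + / 2) ^ 2) by (rewrite minus_IZR; field).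
    replace (sg true (-1 - m)) with (Cmult (RtoC (-1)) (sg true m)); [ring|].
    unfold sg; rewrite !andb_true_l. replace (-1 - m)%Z with (-1 + - m)%Z by lia.
    rewrite Z.odd_add, Z.odd_opp. destruct (Z.odd m); simpl;
      apply injective_projections; simpl; ring. }
  apply HasSum_image in H'; [|intros; lia].
  assert (E : theta z true true = Copp (theta z true true)).
  { eapply HasSum_unique; [exact H|]. revert H'; apply HasSum_ext; auto.
    intros m; split; auto. intros _; exists (-1 - m)%Z; split; auto; lia. }
  revert E. generalize (theta z true true). intros [a b] E. inversion E.
  apply injective_projections; simpl; lra.
Qed.

(** * Sums over integer vectors *)

Fixpoint prodC (n : nat) (f : nat -> C) : C :=
  match n with O => RtoC 1 | S k => Cmult (prodC k f) (f k) end.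

Lemma prodC_ext (n : nat) (f g : nat -> C) :
  (forall k, (k < n)%nat -> f k = g k) -> prodC n f = prodC n g.
Proof. induction n as [|n IH]; simpl; intros H; [reflexivity|]. rewrite IH, H; auto. Qed.

Lemma prodC_mult (n : nat) (f g : nat -> C) :
  prodC n (fun k => Cmult (f k) (g k)) = Cmult (prodC n f) (prodC n g).
Proof. induction n as [|n IH]; simpl; [ring|]. rewrite IH; ring. Qed.

Lemma prodC_app (m n : nat) (f : nat -> C) :
  prodC (m + n) f = Cmult (prodC m f) (prodC n (fun k => f (m + k)%nat)).
Proof.
  induction n as [|n IH]; simpl.
  - rewrite Nat.add_0_r; ring.
  - rewrite Nat.add_succ_r; simpl. rewrite IH; ring.
Qed.

Lemma prodC_const (n : nat) (w : C) : prodC n (fun _ => w) = Complex.Cpow w n.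
Proof. induction n as [|n IH]; simpl; [reflexivity|]. rewrite IH; ring. Qed.

Definition Zvec (n : nat) (u : nat -> Z) : Prop := forall k, (n <= k)%nat -> u k = 0%Z.

Lemma AbsSum_Zvec (n : nat) (f : nat -> Z -> C) (s : nat -> C) :
  (forall k, (k < n)%nat -> AbsSum (fun _ : Z => True) (f k) (s k)) ->
  AbsSum (Zvec n) (fun u => prodC n (fun k => f k (u k))) (prodC n s).
Proof.
  induction n as [|n IH]; intros H.
  - simpl. apply (AbsSum_ext (fun x => x = (fun _ => 0%Z)) _ (fun _ => RtoC 1)); auto.
    + intros u; split; [intros ->; intros k _; reflexivity|].
      intros Hu; apply functional_extensionality; intros k; apply Hu; lia.
    + apply (AbsSum_singleton _ (fun _ => RtoC 1)).
  - set (h := fun (x : (nat -> Z) * Z) k => if Nat.eqb k n then snd x else fst x k).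
    assert (Hh : forall x, h x n = snd x) by (intros x; unfold h; rewrite Nat.eqb_refl; auto).
    assert (Hh' : forall x k, k <> n -> h x k = fst x k).
    { intros x k Hk; unfold h. apply Nat.eqb_neq in Hk; rewrite Hk; auto. }
    pose proof (AbsSum_prod _ _ _ _ _ _ (IH (fun k Hk => H k (Nat.lt_lt_succ_r _ _ Hk))) (H n (Nat.lt_succ_diag_r n))) as P.
    apply (AbsSum_ext (fun u => exists x, (Zvec n (fst x) /\ True) /\ u = h x)
      _ (fun u => prodC (S n) (fun k => f k (u k)))); auto.
    + intros u; split.
      * intros ([v m] & [Hv _] & ->) k Hk. rewrite Hh' by lia. apply Hv; lia.
      * intros Hu. exists (fun k => if Nat.eqb k n then 0%Z else u k, u n).
        split; [split; auto|].
        -- intros k Hk; simpl. destruct (Nat.eqb_spec k n); auto. apply Hu; lia.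
        -- apply functional_extensionality; intros k. unfold h; simpl.
           destruct (Nat.eqb_spec k n); subst; auto.
    + apply AbsSum_image.
      * intros [v m] [v' m'] [Hv _] [Hv' _] E. simpl in *.
        f_equal.
        -- apply functional_extensionality; intros k.
           destruct (Nat.eq_dec k n) as [->|Hk].
           ++ rewrite Hv, Hv'; auto.
           ++ pose proof (f_equal (fun g => g k) E) as E'. simpl in E'.
              rewrite !Hh' in E' by assumption; exact E'.
        -- pose proof (f_equal (fun g => g n) E) as E'. simpl in E'.
           rewrite !Hh in E'; exact E'.
      * revert P; apply AbsSum_ext; [tauto|]. intros x _. simpl. rewrite Hh. f_equal.
        apply prodC_ext; intros k Hk. rewrite Hh' by lia; auto.
Qed.

(** The indicator of a parity class is (1 + (-1)^r)/2 or (1 - (-1)^r)/2, so the sum over the class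
    is half the sum or difference of the plain and the signed series. *)
Lemma HasSum_parity {T} (A : T -> Prop) (r : T -> Z) (f : T -> C) (S0 S1 : C) (b : bool) :
  HasSum A (fun x => Cmult (sg false (r x)) (f x)) S0 ->
  HasSum A (fun x => Cmult (sg true (r x)) (f x)) S1 ->
  HasSum (fun x => A x /\ Z.odd (r x) = b) f
    (Cmult (RtoC (/ 2)) (if b then Cminus S0 S1 else Cplus S0 S1)).
Proof.
  intros H0 H1.
  pose proof (HasSum_lin _ (RtoC (/ 2)) (RtoC (if b then - / 2 else / 2)) _ _ _ _ H0 H1) as H.
  assert (E : HasSum A (fun x => if Bool.eqb (Z.odd (r x)) b then f x else RtoC 0)
     (Cmult (RtoC (/ 2)) (if b then Cminus S0 S1 else Cplus S0 S1))).
  { replace (Cmult (RtoC (/ 2)) _) with (Cplus (Cmult (RtoC (/ 2)) S0)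
      (Cmult (RtoC (if b then - / 2 else / 2)) S1))
      by (destruct b; apply injective_projections; simpl; field).
    revert H; apply HasSum_ext; [tauto|]. intros x _.
    unfold sg; destruct b, (Z.odd (r x)); simpl; apply injective_projections; simpl; field. }
  apply HasSum_restrict in E. revert E; apply HasSum_ext; auto.
  intros x. rewrite Bool.eqb_true_iff; tauto.
Qed.

Lemma sumR_ext (n : nat) (f g : nat -> R) :
  (forall k, (k < n)%nat -> f k = g k) -> sumR n f = sumR n g.
Proof. induction n as [|n IH]; simpl; intros H; [reflexivity|]. rewrite IH, H; auto. Qed.

Lemma sumR_plus (n : nat) (f g : nat -> R) :
  sumR n (fun k => f k + g k) = sumR n f + sumR n g.
Proof. induction n as [|n IH]; simpl; [ring|]. rewrite IH; ring. Qed.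

Lemma sumR_scal (n : nat) (c : R) (f : nat -> R) :
  sumR n (fun k => c * f k) = c * sumR n f.
Proof. induction n as [|n IH]; simpl; [ring|]. rewrite IH; ring. Qed.

Lemma sumR_const (n : nat) (c : R) : sumR n (fun _ => c) = INR n * c.
Proof. induction n as [|n IH]; [simpl; ring|]. rewrite S_INR; simpl sumR; rewrite IH; ring. Qed.

Lemma sumR_delta (n k : nat) (f : nat -> R) :
  (k < n)%nat -> sumR n (fun j => if Nat.eqb j k then f j else 0) = f k.
Proof.
  intros Hk. induction n as [|n IH]; [lia|]; simpl.
  destruct (Nat.eqb_spec n k) as [->|N].
  - rewrite (sumR_ext k _ (fun _ => 0)).
    + rewrite sumR_const; ring.
    + intros j Hj. destruct (Nat.eqb_spec j k); [lia|reflexivity].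
  - rewrite IH by lia; ring.
Qed.

Lemma sumR_app (m n : nat) (f : nat -> R) :
  sumR (m + n) f = sumR m f + sumR n (fun k => f (m + k)%nat).
Proof.
  induction n as [|n IH]; simpl.
  - rewrite Nat.add_0_r; ring.
  - rewrite Nat.add_succ_r; simpl. rewrite IH; ring.
Qed.

Fixpoint sumZ (n : nat) (f : nat -> Z) : Z :=
  match n with O => 0 | S k => sumZ k f + f k end%Z.

Lemma IZR_sumZ (n : nat) (f : nat -> Z) : IZR (sumZ n f) = sumR n (fun k => IZR (f k)).
Proof. induction n as [|n IH]; simpl; [reflexivity|]. rewrite plus_IZR, IH; reflexivity. Qed.

Lemma prodC_sg (n : nat) (b : bool) (f : nat -> Z) :
  prodC n (fun k => sg b (f k)) = sg b (sumZ n f).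
Proof.
  induction n as [|n IH]; simpl.
  - unfold sg; rewrite andb_false_r; reflexivity.
  - rewrite sg_plus, IH; reflexivity.
Qed.

Lemma qpow_sumR (z : C) (n : nat) (f : nat -> R) :
  qpow z (sumR n f) = prodC n (fun k => qpow z (f k)).
Proof. induction n as [|n IH]; simpl; [apply qpow_0|]. rewrite qpow_plus, IH; reflexivity. Qed.

(** Termwise m^2 - m is even. Thus norms modulo 2 are read off from coordinate sums. *)
Lemma sumZ_square_parity (n : nat) (f : nat -> Z) :
  exists t, sumZ n (fun k => f k * f k)%Z = (sumZ n f + 2 * t)%Z.
Proof.
  induction n as [|n [t IH]]; cbn [sumZ]; [exists 0%Z; reflexivity|].
  assert (H : exists s, (f n * f n = f n + 2 * s)%Z).
  { pose proof (Z.div2_odd (f n)) as E. destruct (Z.odd (f n)); unfold Z.b2z in E;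
      rewrite E; generalize (Z.div2 (f n)); intros d.
    - exists (2 * d * d + d)%Z; ring.
    - exists (2 * d * d - d)%Z; ring. }
  destruct H as [s Hs]. exists (t + s)%Z. lia.
Qed.

Definition shift (n : nat) (p : nat -> bool) (u : nat -> Z) (k : nat) : R :=
  if Nat.ltb k n then IZR (u k) + hf (p k) else 0.

Lemma shift_in (n : nat) p u (k : nat) : (k < n)%nat -> shift n p u k = IZR (u k) + hf (p k).
Proof. intros H; unfold shift. apply Nat.ltb_lt in H; rewrite H; reflexivity. Qed.

Lemma HasSum_shift (z : C) (n : nat) (p b : nat -> bool) :
  Im z > 0 ->
  HasSum (Zvec n)
    (fun u => Cmult (prodC n (fun k => sg (b k) (u k)))
                (qpow z (ip n (shift n p u) (shift n p u))))
    (prodC n (fun k => theta z (p k) (b k))).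
Proof.
  intros Hz.
  pose proof (proj1 (AbsSum_Zvec n (fun k => theta_term z (p k) (b k)) _
    (fun k _ => theta_AbsSum z (p k) (b k) Hz))) as H.
  revert H; apply HasSum_ext; [tauto|]. intros u _.
  unfold ip. rewrite qpow_sumR, <- prodC_mult. apply prodC_ext; intros k Hk.
  rewrite shift_in by assumption. unfold theta_term. do 2 f_equal; ring.
Qed.

(** * Jacobi's identity *)

Definition vec4 (a b c d : Z) (k : nat) : Z :=
  match k with 0 => a | 1 => b | 2 => c | 3 => d | _ => 0%Z end%nat.

Lemma Zvec4 (u : nat -> Z) : Zvec 4 u -> u = vec4 (u 0%nat) (u 1%nat) (u 2%nat) (u 3%nat).
Proof.
  intros H; apply functional_extensionality; intros [|[|[|[|k]]]]; try reflexivity.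
  simpl. apply H; lia.
Qed.

(** On an integer vector of odd sum, half the Hadamard matrix has half-integral entries. The
    subtracted 1 removes the 1/2 that [shift] with flag [true] puts back. *)
Definition hadamard_shift (u : nat -> Z) : nat -> Z :=
  let a := u 0%nat in let b := u 1%nat in let c := u 2%nat in let d := u 3%nat in
  vec4 ((a + b + c + d - 1) / 2) ((a + b - c - d - 1) / 2)
       ((a - b + c - d - 1) / 2) ((a - b - c + d - 1) / 2).

Lemma odd_div (m : Z) : Z.odd m = true -> (m = 2 * ((m - 1) / 2) + 1)%Z.
Proof.
  intros H. apply Z.odd_spec in H as [k ->].
  replace (2 * k + 1 - 1)%Z with (k * 2)%Z by ring. rewrite Z.div_mul; lia.
Qed.

Lemma HasSum_Z4 (z : C) (p r : bool) :
  Im z > 0 ->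
  HasSum (fun u => Zvec 4 u /\ Z.odd (sumZ 4 u) = r)
    (fun u => qpow z (ip 4 (shift 4 (fun _ => p) u) (shift 4 (fun _ => p) u)))
    (Cmult (RtoC (/ 2))
       (if r then Cminus (Complex.Cpow (theta z p false) 4) (Complex.Cpow (theta z p true) 4)
        else Cplus (Complex.Cpow (theta z p false) 4) (Complex.Cpow (theta z p true) 4))).
Proof.
  intros Hz. apply HasSum_parity; rewrite <- prodC_const;
  [ pose proof (HasSum_shift z 4 (fun _ => p) (fun _ => false) Hz) as H
  | pose proof (HasSum_shift z 4 (fun _ => p) (fun _ => true) Hz) as H ];
  revert H; apply HasSum_ext; try tauto; intros u _; rewrite prodC_sg; reflexivity.
Qed.

(* Triality of D4: half the 4x4 Hadamard matrix is an involutive isometry carrying the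
   integer vectors of odd coordinate sum onto the vectors of Z^4 + (1/2,1/2,1/2,1/2)
   of even coordinate sum. *)
Lemma jacobi (z : C) : Im z > 0 ->
  Complex.Cpow (theta3 z) 4 = Cplus (Complex.Cpow (theta2 z) 4) (Complex.Cpow (theta4 z) 4).
Proof.
  intros Hz. rewrite theta2_eq, theta3_eq, theta4_eq.
  pose proof (HasSum_Z4 z false true Hz) as H1.
  pose proof (HasSum_Z4 z true false Hz) as H2. cbv iota in H1, H2.
  rewrite (theta_half_sign z Hz) in H2.
  assert (K : forall u, Zvec 4 u -> Z.odd (sumZ 4 u) = true -> exists a b c d e f g h : Z,
     (u = vec4 a b c d /\ hadamard_shift u = vec4 e f g h /\
      a + b + c + d = 2 * e + 1 /\ a + b - c - d = 2 * f + 1 /\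
      a - b + c - d = 2 * g + 1 /\ a - b - c + d = 2 * h + 1)%Z).
  { intros u Hu Ho. rewrite (Zvec4 u Hu) in *. simpl in Ho.
    generalize dependent (u 0%nat); intros a; generalize (u 1%nat); intros b;
    generalize (u 2%nat); intros c; generalize (u 3%nat); intros d Ho.
    exists a, b, c, d, ((a + b + c + d - 1) / 2)%Z, ((a + b - c - d - 1) / 2)%Z,
      ((a - b + c - d - 1) / 2)%Z, ((a - b - c + d - 1) / 2)%Z.
    split; [reflexivity|]; split; [reflexivity|].
    repeat split; apply odd_div; rewrite <- Ho;
      unfold Z.sub; rewrite !Z.odd_add, ?Z.odd_opp;
      destruct (Z.odd a), (Z.odd b), (Z.odd c), (Z.odd d); reflexivity. }
  assert (H3 : HasSum (fun w => Zvec 4 w /\ Z.odd (sumZ 4 w) = false)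
    (fun u => qpow z (ip 4 (shift 4 (fun _ => true) u) (shift 4 (fun _ => true) u)))
    (Cmult (RtoC (/ 2)) (Cminus (Complex.Cpow (theta z false false) 4)
                                (Complex.Cpow (theta z false true) 4)))).
  { apply (HasSum_ext (fun w => exists u, (Zvec 4 u /\ Z.odd (sumZ 4 u) = true) /\ w = hadamard_shift u) _
      (fun u => qpow z (ip 4 (shift 4 (fun _ => true) u) (shift 4 (fun _ => true) u)))); auto.
    - intros w; split.
      + intros (u & [Hu Ho] & ->).
        destruct (K u Hu Ho) as (a & b & c & d & e & f & g & h & -> & -> & E1 & E2 & E3 & E4).
        split.
        * intros k Hk. destruct k as [|[|[|[|k]]]]; try lia; reflexivity.
        (* Adding the four equations [E1] to [E4] leaves 4a = 2(e + f + g + h) + 4. *)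
        * simpl. replace (e + f + g + h)%Z with (2 * (a - 1))%Z by lia.
          rewrite Z.odd_mul; reflexivity.
      + intros [Hw Ho]. rewrite (Zvec4 w Hw) in *. simpl in Ho.
        generalize dependent (w 0%nat); intros a; generalize (w 1%nat); intros b;
        generalize (w 2%nat); intros c; generalize (w 3%nat); intros d Ho.
        assert (Ev : exists k, (a + b + c + d = 2 * k)%Z).
        { apply Z.even_spec. rewrite <- Z.negb_odd, Ho; reflexivity. }
        destruct Ev as [k Ek].
        (* The isometry is its own inverse, so the preimage is its value at (a + 1/2, b + 1/2, c +
           1/2, d + 1/2). With a + b + c + d = 2k the halves add up to 1 in the first entry and
           cancel in the others. *)
        exists (vec4 (k + 1) (k - c - d) (k - b - d) (k - b - c)). split; [split|].
        * intros j Hj. destruct j as [|[|[|[|j]]]]; try lia; reflexivity.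
        * simpl. replace (k + 1 + (k - c - d) + (k - b - d) + (k - b - c))%Z
            with (1 + 2 * (2 * k - b - c - d))%Z by lia.
          rewrite Z.odd_add, Z.odd_mul; reflexivity.
        * unfold hadamard_shift; simpl.
          f_equal; apply Z.div_unique with 0%Z; lia.
    - apply HasSum_image.
      + intros u v [Hu Hou] [Hv Hov] E.
        destruct (K u Hu Hou) as (a & b & c & d & e & f & g & h & -> & Eh & E1 & E2 & E3 & E4).
        destruct (K v Hv Hov) as (a' & b' & c' & d' & e' & f' & g' & h' & -> & Eh' & E1' & E2' & E3' & E4').
        rewrite Eh, Eh' in E.
        pose proof (f_equal (fun w => w 0%nat) E) as X0; pose proof (f_equal (fun w => w 1%nat) E) as X1.
        pose proof (f_equal (fun w => w 2%nat) E) as X2; pose proof (f_equal (fun w => w 3%nat) E) as X3.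
        cbv beta iota delta [vec4] in X0, X1, X2, X3. f_equal; lia.
      + revert H1; apply HasSum_ext; [tauto|]. intros u [Hu Ho].
        destruct (K u Hu Ho) as (a & b & c & d & e & f & g & h & -> & -> & E1 & E2 & E3 & E4).
        f_equal. unfold ip, shift, hf; simpl.
        apply (f_equal IZR) in E1, E2, E3, E4.
        repeat first [rewrite plus_IZR in E1 | rewrite mult_IZR in E1].
        repeat first [rewrite plus_IZR in E2 | rewrite minus_IZR in E2 | rewrite mult_IZR in E2].
        repeat first [rewrite plus_IZR in E3 | rewrite minus_IZR in E3 | rewrite mult_IZR in E3].
        repeat first [rewrite plus_IZR in E4 | rewrite minus_IZR in E4 | rewrite mult_IZR in E4].
        set (A := IZR a) in *. set (B := IZR b) in *. set (C := IZR c) in *. set (D := IZR d) in *.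
        replace (IZR e) with ((A + B + C + D - 1) / 2) by lra.
        replace (IZR f) with ((A + B - C - D - 1) / 2) by lra.
        replace (IZR g) with ((A - B + C - D - 1) / 2) by lra.
        replace (IZR h) with ((A - B - C + D - 1) / 2) by lra.
        field. }
  pose proof (HasSum_unique _ _ _ _ H2 H3) as E.
  apply (f_equal (Cmult (RtoC 2))) in E. rewrite !Cmult_assoc in E.
  replace (Cmult (RtoC 2) (RtoC (/ 2))) with (RtoC 1) in E by (apply injective_projections; simpl; field).
  rewrite !Cmult_1_l in E.
  set (x := Complex.Cpow (theta z false false) 4) in *.
  set (y := Complex.Cpow (theta z false true) 4) in *.
  replace x with (Cplus (Cminus x y) y) by ring. rewrite <- E.
  simpl; ring.
Qed.

(** * Blocks of coordinates *)

Definition off (ns : nat -> nat) (i : nat) : nat := nbar ns (i - 1).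

Lemma block_cases (i : nat) : (1 <= i <= 4)%nat -> i = 1%nat \/ i = 2%nat \/ i = 3%nat \/ i = 4%nat.
Proof. lia. Qed.

(** Indices beyond the last block also receive 4; [lift] is zero there, so this value is never
    seen. *)
Definition blk (ns : nat -> nat) (k : nat) : nat :=
  if Nat.ltb k (nbar ns 1%nat) then 1%nat else if Nat.ltb k (nbar ns 2%nat) then 2%nat
  else if Nat.ltb k (nbar ns 3%nat) then 3%nat else 4%nat.

Lemma blk_off (ns : nat -> nat) (i j : nat) : (1 <= i <= 4)%nat -> (j < ns i)%nat -> blk ns (off ns i + j) = i.
Proof.
  intros Hi Hj. unfold blk, off, nbar.
  apply block_cases in Hi as [->|[->|[->| ->]]]; simpl;
  repeat match goal with |- context [Nat.ltb ?a ?b] => destruct (Nat.ltb_spec a b) end; lia.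
Qed.

Lemma off_lt (ns : nat -> nat) (i j : nat) : (1 <= i <= 4)%nat -> (j < ns i)%nat -> (off ns i + j < nbar ns 4%nat)%nat.
Proof.
  intros Hi Hj. unfold off, nbar.
  apply block_cases in Hi as [->|[->|[->| ->]]]; simpl; lia.
Qed.

Lemma index_split (ns : nat -> nat) (k : nat) : (k < nbar ns 4%nat)%nat ->
  exists i j, (1 <= i <= 4)%nat /\ (j < ns i)%nat /\ k = (off ns i + j)%nat.
Proof.
  intros Hk. unfold off, nbar in *; simpl in *.
  destruct (Nat.lt_ge_cases k (ns 1%nat)%nat).
  { exists 1%nat, k; simpl; repeat split; lia. }
  destruct (Nat.lt_ge_cases k (ns 1%nat + ns 2%nat)%nat).
  { exists 2%nat, (k - ns 1%nat)%nat; simpl; repeat split; lia. }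
  destruct (Nat.lt_ge_cases k (ns 1%nat + ns 2%nat + ns 3%nat)%nat).
  { exists 3%nat, (k - ns 1%nat - ns 2%nat)%nat; simpl; repeat split; lia. }
  exists 4%nat, (k - ns 1%nat - ns 2%nat - ns 3%nat)%nat; simpl; repeat split; lia.
Qed.

Definition bsR (ns : nat -> nat) (f : nat -> R) (i : nat) : R := sumR (ns i) (fun j => f (off ns i + j)%nat).
Definition bsZ (ns : nat -> nat) (f : nat -> Z) (i : nat) : Z := sumZ (ns i) (fun j => f (off ns i + j)%nat).

Lemma n_split (ns : nat -> nat) : nbar ns 4%nat = (ns 1%nat + (ns 2%nat + (ns 3%nat + ns 4%nat)))%nat.
Proof. unfold nbar; simpl; lia. Qed.

Lemma sumR_blocks (ns : nat -> nat) (f : nat -> R) : sumR (nbar ns 4%nat) f = bsR ns f 1 + bsR ns f 2 + bsR ns f 3 + bsR ns f 4.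
Proof.
  rewrite n_split, !sumR_app. unfold bsR, off, nbar; simpl.
  rewrite !Rplus_assoc. repeat f_equal; apply functional_extensionality; intros j; f_equal; lia.
Qed.

Lemma prodC_blocks (ns : nat -> nat) (f : nat -> C) : prodC (nbar ns 4%nat) f =
  Cmult (prodC (ns 1%nat) (fun j => f (off ns 1 + j)%nat)) (Cmult (prodC (ns 2%nat) (fun j => f (off ns 2 + j)%nat))
   (Cmult (prodC (ns 3%nat) (fun j => f (off ns 3 + j)%nat)) (prodC (ns 4%nat) (fun j => f (off ns 4 + j)%nat)))).
Proof.
  rewrite n_split, !prodC_app. unfold off, nbar; simpl.
  repeat f_equal; apply functional_extensionality; intros j; f_equal; lia.
Qed.

Lemma IZR_bsZ (ns : nat -> nat) (f : nat -> Z) (i : nat) : IZR (bsZ ns f i) = bsR ns (fun k => IZR (f k)) i.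
Proof. apply IZR_sumZ. Qed.

Lemma xv1_block (ns : nat -> nat) (i i' j : nat) : (1 <= i <= 4)%nat -> (1 <= i' <= 4)%nat -> (j < ns i')%nat ->
  xv1 ns i (off ns i' + j) = if Nat.eqb i i' then / 2 else 0.
Proof.
  intros Hi Hi' Hj. unfold xv1, off, nbar.
  apply block_cases in Hi as [->|[->|[->| ->]]]; apply block_cases in Hi' as [->|[->|[->| ->]]]; simpl;
  repeat match goal with
  | |- context [Nat.leb ?a ?b] => destruct (Nat.leb_spec a b)
  | |- context [Nat.ltb ?a ?b] => destruct (Nat.ltb_spec a b) end; simpl; try reflexivity; lia.
Qed.

Lemma xv2_block (ns : nat -> nat) (i i' j : nat) : (forall i, (1 <= i <= 4)%nat -> (0 < ns i)%nat) ->
  (1 <= i <= 4)%nat -> (1 <= i' <= 4)%nat -> (j < ns i')%nat ->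
  xv2 ns i (off ns i' + j) = if Nat.eqb i i' then if Nat.eqb j 0 then 1 else 0 else 0.
Proof.
  intros Hpos Hi Hi' Hj. unfold xv2, off, nbar.
  pose proof (Hpos 1%nat); pose proof (Hpos 2%nat); pose proof (Hpos 3%nat); pose proof (Hpos 4%nat).
  apply block_cases in Hi as [->|[->|[->| ->]]]; apply block_cases in Hi' as [->|[->|[->| ->]]]; simpl;
  repeat match goal with
  | |- context [Nat.eqb ?a ?b] => destruct (Nat.eqb_spec a b) end; simpl; try reflexivity; lia.
Qed.

Lemma xv_outside (ns : nat -> nat) (i k : nat) : (forall i, (1 <= i <= 4)%nat -> (0 < ns i)%nat) ->
  (1 <= i <= 4)%nat -> (nbar ns 4%nat <= k)%nat -> xv1 ns i k = 0 /\ xv2 ns i k = 0.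
Proof.
  intros Hpos Hi Hk. unfold xv1, xv2, nbar in *.
  pose proof (Hpos 1%nat); pose proof (Hpos 2%nat); pose proof (Hpos 3%nat); pose proof (Hpos 4%nat).
  apply block_cases in Hi as [->|[->|[->| ->]]]; simpl in *;
  repeat match goal with
  | |- context [Nat.eqb ?a ?b] => destruct (Nat.eqb_spec a b)
  | |- context [Nat.leb ?a ?b] => destruct (Nat.leb_spec a b)
  | |- context [Nat.ltb ?a ?b] => destruct (Nat.ltb_spec a b) end; simpl; try (split; reflexivity); lia.
Qed.

Definition sel {T} (x1 x2 x3 x4 : T) (i : nat) : T :=
  match i with 1 => x1 | 2 => x2 | 3 => x3 | _ => x4 end%nat.

Definition lift (ns : nat -> nat) (p : nat -> bool) : (nat -> Z) -> nat -> R :=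
  shift (nbar ns 4) (fun k => p (blk ns k)).

Lemma lift_block ns p u (i j : nat) : (1 <= i <= 4)%nat -> (j < ns i)%nat ->
  lift ns p u (off ns i + j)%nat = IZR (u (off ns i + j)%nat) + hf (p i).
Proof.
  intros Hi Hj. unfold lift. rewrite shift_in by (apply off_lt; assumption).
  rewrite blk_off by assumption; reflexivity.
Qed.

Lemma lift_inRn ns p u : inRn (nbar ns 4) (lift ns p u).
Proof. intros k Hk; unfold lift, shift. apply Nat.ltb_ge in Hk; rewrite Hk; reflexivity. Qed.

Lemma vec_eq_blocks (ns : nat -> nat) (a a' : nat -> R) :
  inRn (nbar ns 4) a -> inRn (nbar ns 4) a' ->
  (forall i j, (1 <= i <= 4)%nat -> (j < ns i)%nat -> a (off ns i + j)%nat = a' (off ns i + j)%nat) ->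
  forall k, a k = a' k.
Proof.
  intros H H' E k. destruct (Nat.lt_ge_cases k (nbar ns 4)) as [Hk|Hk].
  - destruct (index_split ns k Hk) as (i & j & Hi & Hj & ->). auto.
  - rewrite H, H'; auto.
Qed.

(** * Cosets of the glue code *)

(* Write 0, 1, 2, 3 for the cosets of 0, x_1, x_2, x_3 in the dual of D_{n_i} modulo D_{n_i}.
   A word of the glue code is determined by the set of blocks carrying 2 or 3, which is
   [r]; the blocks carrying 1 or 3, the half-integral ones, are then [glue_half xorb r]. *)
Definition glue_half {T} (add : T -> T -> T) (r : nat -> T) : nat -> T :=
  sel (add (r 3%nat) (r 4%nat)) (add (r 4%nat) (r 1%nat))
      (add (r 1%nat) (r 2%nat)) (add (r 2%nat) (r 3%nat)).

Definition glue_coset (ns : nat -> nat) (r : nat -> bool) (a : nat -> R) : Prop :=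
  exists u, (Zvec (nbar ns 4) u /\ forall i, (1 <= i <= 4)%nat -> Z.odd (bsZ ns u i) = r i) /\
    a = lift ns (glue_half xorb r) u.

(** The theta series of one coset of D_{n_i} in its dual, as an average over the two characters of
    the parity of the integer part. *)
Definition block_factor (z : C) (ns : nat -> nat) (p r : nat -> bool) (i : nat) : C :=
  let T0 := Complex.Cpow (theta z (p i) false) (ns i) in
  let T1 := Complex.Cpow (theta z (p i) true) (ns i) in
  Cmult (RtoC (/ 2)) (if r i then Cminus T0 T1 else Cplus T0 T1).

(** Each coordinate takes the sign and the shift of its block, so the product over coordinates
    collapses to four powers. The signs are nested so that [HasSum_parity] can strip them one at a
    time. *)
Lemma HasSum_blocks (z : C) (ns : nat -> nat) (p : nat -> bool) (b1 b2 b3 b4 : bool) :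
  Im z > 0 ->
  HasSum (Zvec (nbar ns 4))
    (fun u => Cmult (sg b1 (bsZ ns u 1)) (Cmult (sg b2 (bsZ ns u 2))
       (Cmult (sg b3 (bsZ ns u 3)) (Cmult (sg b4 (bsZ ns u 4))
         (qpow z (ip (nbar ns 4) (lift ns p u) (lift ns p u)))))))
    (Cmult (Complex.Cpow (theta z (p 1%nat) b1) (ns 1%nat))
      (Cmult (Complex.Cpow (theta z (p 2%nat) b2) (ns 2%nat))
      (Cmult (Complex.Cpow (theta z (p 3%nat) b3) (ns 3%nat))
             (Complex.Cpow (theta z (p 4%nat) b4) (ns 4%nat))))).
Proof.
  intros Hz.
  pose proof (HasSum_shift z (nbar ns 4) (fun k => p (blk ns k))
    (fun k => sel b1 b2 b3 b4 (blk ns k)) Hz) as H.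
  rewrite prodC_blocks in H.
  replace (Cmult (Complex.Cpow (theta z (p 1%nat) b1) (ns 1%nat)) _) with
    (Cmult (prodC (ns 1%nat) (fun j => theta z (p (blk ns (off ns 1 + j))) (sel b1 b2 b3 b4 (blk ns (off ns 1 + j)))))
    (Cmult (prodC (ns 2%nat) (fun j => theta z (p (blk ns (off ns 2 + j))) (sel b1 b2 b3 b4 (blk ns (off ns 2 + j)))))
    (Cmult (prodC (ns 3%nat) (fun j => theta z (p (blk ns (off ns 3 + j))) (sel b1 b2 b3 b4 (blk ns (off ns 3 + j)))))
    (prodC (ns 4%nat) (fun j => theta z (p (blk ns (off ns 4 + j))) (sel b1 b2 b3 b4 (blk ns (off ns 4 + j))))))))
    by (rewrite <- !prodC_const; repeat apply (f_equal2 Cmult); try reflexivity; apply prodC_ext; intros j Hj;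
        rewrite blk_off by (auto; lia); reflexivity).
  revert H; apply HasSum_ext; [tauto|]. intros u _.
  rewrite prodC_blocks. unfold bsZ. rewrite <- !prodC_sg. fold (lift ns p u). unfold lift.
  rewrite <- !Cmult_assoc.
  repeat apply (f_equal2 Cmult); try reflexivity; apply prodC_ext; intros j Hj; rewrite blk_off by (auto; lia); reflexivity.
Qed.

Lemma HasSum_lift (z : C) (ns : nat -> nat) (p r : nat -> bool) :
  Im z > 0 ->
  HasSum (fun u => Zvec (nbar ns 4) u /\ forall i, (1 <= i <= 4)%nat -> Z.odd (bsZ ns u i) = r i)
    (fun u => qpow z (ip (nbar ns 4) (lift ns p u) (lift ns p u)))
    (Cmult (block_factor z ns p r 1) (Cmult (block_factor z ns p r 2)
       (Cmult (block_factor z ns p r 3) (block_factor z ns p r 4)))).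
Proof.
  intros Hz.
  (* Each use removes the outermost sign by fixing the parity of one block and leaves the remaining
     signs free for the next use. *)
  pose proof (fun b2 b3 b4 => HasSum_parity _ _ _ _ _ (r 1%nat)
      (HasSum_blocks z ns p false b2 b3 b4 Hz) (HasSum_blocks z ns p true b2 b3 b4 Hz)) as H1.
  pose proof (fun b3 b4 => HasSum_parity _ _ _ _ _ (r 2%nat) (H1 false b3 b4) (H1 true b3 b4)) as H2.
  pose proof (fun b4 => HasSum_parity _ _ _ _ _ (r 3%nat) (H2 false b4) (H2 true b4)) as H3.
  pose proof (HasSum_parity _ _ _ _ _ (r 4%nat) (H3 false) (H3 true)) as H4.
  clear H1 H2 H3. match type of H4 with HasSum _ _ ?s => replace s with
    (Cmult (block_factor z ns p r 1) (Cmult (block_factor z ns p r 2)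
       (Cmult (block_factor z ns p r 3) (block_factor z ns p r 4)))) in H4 end.
  - revert H4; apply HasSum_ext; auto. intros u; split.
    + intros [[[[H H1] H2] H3] H4]; split; auto.
      intros i Hi; apply block_cases in Hi as [->|[->|[->| ->]]]; assumption.
    + intros [H H']. repeat split; auto; apply H'; lia.
  - unfold block_factor. destruct (r 1%nat), (r 2%nat), (r 3%nat), (r 4%nat); ring.
Qed.

(** Equal entries with different shifts would make an even integer equal to an odd one. Allowing [p]
    and [p'] to differ makes the lemma serve for disjointness of the cosets as well as for
    reindexing. *)
Lemma lift_inj ns p p' u u' : (forall i, (1 <= i <= 4)%nat -> (0 < ns i)%nat) ->
  Zvec (nbar ns 4) u -> Zvec (nbar ns 4) u' -> lift ns p u = lift ns p' u' ->
  u = u'.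
Proof.
  intros Hpos Hu Hu' E. apply functional_extensionality; intros k.
  destruct (Nat.lt_ge_cases k (nbar ns 4)) as [Hk|Hk].
  - destruct (index_split ns k Hk) as (i & j & Hi & Hj & ->).
    apply (f_equal (fun a => a (off ns i + j)%nat)) in E. rewrite !lift_block in E by assumption.
    unfold hf in E. destruct (p i), (p' i); try (apply eq_IZR; lra); exfalso.
    + assert (E' : IZR (2 * u (off ns i + j)%nat + 1) = IZR (2 * u' (off ns i + j)%nat))
        by (rewrite plus_IZR, !mult_IZR; lra).
      apply eq_IZR in E'; lia.
    + assert (E' : IZR (2 * u (off ns i + j)%nat) = IZR (2 * u' (off ns i + j)%nat + 1))
        by (rewrite plus_IZR, !mult_IZR; lra).
      apply eq_IZR in E'; lia.
  - rewrite Hu, Hu'; auto.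
Qed.

Lemma HasSum_glue_coset (z : C) (ns : nat -> nat) (r : nat -> bool) :
  (forall i, (1 <= i <= 4)%nat -> (0 < ns i)%nat) -> Im z > 0 ->
  let p := glue_half xorb r in
  HasSum (glue_coset ns r) (fun a => qpow z (ip (nbar ns 4) a a))
    (Cmult (block_factor z ns p r 1) (Cmult (block_factor z ns p r 2)
       (Cmult (block_factor z ns p r 3) (block_factor z ns p r 4)))).
Proof.
  intros Hpos Hz p. apply HasSum_image; [|apply HasSum_lift; assumption].
  intros u u' [Hu _] [Hu' _] E. eapply lift_inj; eauto.
Qed.

Lemma glue_coset_unique ns r r' a : (forall i, (1 <= i <= 4)%nat -> (0 < ns i)%nat) ->
  glue_coset ns r a -> glue_coset ns r' a -> forall i, (1 <= i <= 4)%nat -> r i = r' i.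
Proof.
  intros Hpos (u & [Hu Hr] & E) (u' & [Hu' Hr'] & E') i Hi.
  rewrite E in E'. apply lift_inj in E'; auto. subst u'. rewrite <- Hr, <- Hr'; auto.
Qed.

Definition sum_bool (f : bool -> C) : C := Cplus (f true) (f false).

Lemma HasSum_glue_cosets (z : C) (ns : nat -> nat) :
  (forall i, (1 <= i <= 4)%nat -> (0 < ns i)%nat) -> Im z > 0 ->
  HasSum (fun a => exists r1 r2 r3 r4, glue_coset ns (sel r1 r2 r3 r4) a)
    (fun a => qpow z (ip (nbar ns 4) a a))
    (sum_bool (fun r1 => sum_bool (fun r2 => sum_bool (fun r3 => sum_bool (fun r4 =>
      let r := sel r1 r2 r3 r4 in let p := glue_half xorb r in
      Cmult (block_factor z ns p r 1) (Cmult (block_factor z ns p r 2)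
       (Cmult (block_factor z ns p r 3) (block_factor z ns p r 4)))))))).
Proof.
  intros Hpos Hz.
  apply HasSum_bool.
  { intros a b b' (? & ? & ? & H) (? & ? & ? & H').
    exact (glue_coset_unique ns _ _ a Hpos H H' 1%nat ltac:(lia)). }
  intros r1. apply HasSum_bool.
  { intros a b b' (? & ? & H) (? & ? & H').
    exact (glue_coset_unique ns _ _ a Hpos H H' 2%nat ltac:(lia)). }
  intros r2. apply HasSum_bool.
  { intros a b b' (? & H) (? & H').
    exact (glue_coset_unique ns _ _ a Hpos H H' 3%nat ltac:(lia)). }
  intros r3. apply HasSum_bool.
  { intros a b b' H H'.
    exact (glue_coset_unique ns _ _ a Hpos H H' 4%nat ltac:(lia)). }
  intros r4. apply HasSum_glue_coset; assumption.
Qed.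

(** * The lattice *)

Definition glue_comb (ns : nat -> nat) (c1 c2 c3 c4 : Z) (k : nat) : R :=
  IZR c1 * gen ns 1 k + IZR c2 * gen ns 2 k + IZR c3 * gen ns 3 k + IZR c4 * gen ns 4 k.

(** Once every x_3 is expanded as x_1 + x_2, [comb_half] collects the coefficient of x_1 in each
    block and [comb_int] that of x_2. *)
Definition comb_half (c1 c2 c3 c4 : Z) : nat -> Z :=
  sel (c2 + c3)%Z (c3 + c4)%Z (c1 + c4)%Z (c1 + c2)%Z.

Definition comb_int (c1 c2 c3 c4 : Z) : nat -> Z :=
  sel (c1 + c2 + c3)%Z (c2 + c3 + c4)%Z (c1 + c3 + c4)%Z (c1 + c2 + c4)%Z.

Lemma glue_comb_block ns c1 c2 c3 c4 (i j : nat) :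
  (forall i, (1 <= i <= 4)%nat -> (0 < ns i)%nat) -> (1 <= i <= 4)%nat -> (j < ns i)%nat ->
  glue_comb ns c1 c2 c3 c4 (off ns i + j) =
    IZR (comb_half c1 c2 c3 c4 i) / 2 + (if Nat.eqb j 0 then IZR (comb_int c1 c2 c3 c4 i) else 0).
Proof.
  intros Hpos Hi Hj. unfold glue_comb, gen, xv3.
  rewrite !xv1_block, !xv2_block by (auto; lia).
  apply block_cases in Hi as [->|[->|[->| ->]]]; simpl; rewrite !plus_IZR;
    destruct (Nat.eqb j 0); field.
Qed.

Lemma glue_comb_inRn ns c1 c2 c3 c4 :
  (forall i, (1 <= i <= 4)%nat -> (0 < ns i)%nat) -> inRn (nbar ns 4) (glue_comb ns c1 c2 c3 c4).
Proof.
  intros Hpos k Hk. unfold glue_comb, gen, xv3.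
  destruct (xv_outside ns 1 k Hpos) as [-> ->]; [lia|assumption|].
  destruct (xv_outside ns 2 k Hpos) as [-> ->]; [lia|assumption|].
  destruct (xv_outside ns 3 k Hpos) as [-> ->]; [lia|assumption|].
  destruct (xv_outside ns 4 k Hpos) as [-> ->]; [lia|assumption|]. ring.
Qed.

Lemma integer_choice (b : nat -> R) :
  (forall k, exists m : Z, b k = IZR m) -> exists za : nat -> Z, forall k, b k = IZR (za k).
Proof.
  intros H. exists (fun k => proj1_sig (constructive_indefinite_description _ (H k))).
  intros k; exact (proj2_sig (constructive_indefinite_description _ (H k))).
Qed.

(** Glue vectors are constant on a block except for an extra integer at its first coordinate; this
    computes the block sum after such a perturbation. *)
Lemma bsR_affine (ns : nat -> nat) (f u : nat -> R) (c d : R) (i : nat) : (0 < ns i)%nat ->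
  (forall j, (j < ns i)%nat -> f (off ns i + j)%nat = u (off ns i + j)%nat + c + (if Nat.eqb j 0 then d else 0)) ->
  bsR ns f i = bsR ns u i + INR (ns i) * c + d.
Proof.
  intros Hpos H. unfold bsR. rewrite (sumR_ext _ _ _ H), !sumR_plus, sumR_const.
  rewrite (sumR_delta (ns i) 0 (fun _ => d)) by assumption. reflexivity.
Qed.

Definition block_sizes (ns : nat -> nat) (e : nat) : Prop :=
  forall i, (1 <= i <= 4)%nat -> exists h, ns i = (8 * h + 4 * e + 2)%nat.

Lemma block_sizes_pos ns e : block_sizes ns e -> forall i, (1 <= i <= 4)%nat -> (0 < ns i)%nat.
Proof. intros H i Hi. destruct (H i Hi) as [h ->]. lia. Qed.

Lemma inL_of_inQ ns b : inQ ns b -> inL ns b.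
Proof. intros H. exists 0%Z, 0%Z, 0%Z, 0%Z, b. split; auto. intros k; ring. Qed.

Lemma inL_glue_comb ns c1 c2 c3 c4 : inL ns (glue_comb ns c1 c2 c3 c4).
Proof.
  exists c1, c2, c3, c4, (fun _ => 0). split; [|intros k; unfold glue_comb; ring].
  split; [intros k _; reflexivity|]; split.
  - exists (fun _ => 0%Z); reflexivity.
  - intros i _. exists 0%Z. rewrite sumR_const. ring.
Qed.

Lemma inL_plus ns a b : inL ns a -> inL ns b -> inL ns (fun k => a k + b k).
Proof.
  intros (c1 & c2 & c3 & c4 & q & (Q1 & (zq & Q2) & Q3) & E)
         (c1' & c2' & c3' & c4' & q' & (Q1' & (zq' & Q2') & Q3') & E').
  exists (c1 + c1')%Z, (c2 + c2')%Z, (c3 + c3')%Z, (c4 + c4')%Z, (fun k => q k + q' k).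
  split; [split; [|split]|].
  - intros k Hk. rewrite Q1, Q1' by assumption; ring.
  - exists (fun k => zq k + zq' k)%Z. intros k. rewrite Q2, Q2', plus_IZR; reflexivity.
  - intros i Hi. destruct (Q3 i Hi) as [t Ht], (Q3' i Hi) as [t' Ht'].
    exists (t + t')%Z. rewrite sumR_plus, Ht, Ht', plus_IZR; ring.
  - intros k. rewrite E, E', !plus_IZR; ring.
Qed.

Lemma inL_inRn ns e a : block_sizes ns e -> inL ns a -> inRn (nbar ns 4) a.
Proof.
  intros Hns (c1 & c2 & c3 & c4 & q & (Q1 & _) & E) k Hk.
  rewrite E, Q1 by assumption.
  pose proof (glue_comb_inRn ns c1 c2 c3 c4 (block_sizes_pos _ _ Hns) k Hk) as H.
  unfold glue_comb in H; rewrite H; ring.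
Qed.

(** Membership is a condition modulo 2: the halves in each block must match the parities of the
    integer parts through the glue code. Coefficients of the four generators are found by inverting
    that code over F_2, and the difference then lands in Q. *)
Lemma inL_intro ns e (P : nat -> Z) (u : nat -> Z) (a : nat -> R) : block_sizes ns e ->
  inRn (nbar ns 4) a ->
  (forall i j, (1 <= i <= 4)%nat -> (j < ns i)%nat ->
     a (off ns i + j)%nat = IZR (u (off ns i + j)%nat) + IZR (P i) / 2) ->
  (forall i, (1 <= i <= 4)%nat -> exists t, P i = (glue_half Z.add (bsZ ns u) i + 2 * t)%Z) ->
  inL ns a.
Proof.
  intros Hns Ha Hau HP. pose proof (block_sizes_pos _ _ Hns) as Hpos.
  set (s := bsZ ns u) in *. set (T := (s 1%nat + s 2%nat + s 3%nat + s 4%nat)%Z).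
  (* Each [comb_int] omits exactly one coefficient, so modulo 2 that coefficient is the total plus
     the parity of the block. With this choice [comb_int] at i equals 4T - s_i, and [comb_half]
     exceeds [glue_half Z.add s] by 2T. *)
  set (c1 := (T + s 2%nat)%Z). set (c2 := (T + s 3%nat)%Z).
  set (c3 := (T + s 4%nat)%Z). set (c4 := (T + s 1%nat)%Z).
  set (b := fun k => a k - glue_comb ns c1 c2 c3 c4 k).
  exists c1, c2, c3, c4, b. split; [|intros k; unfold b, glue_comb; ring].
  assert (HD : forall i, (1 <= i <= 4)%nat -> exists t, P i = (comb_half c1 c2 c3 c4 i + 2 * t)%Z).
  { intros i Hi. destruct (HP i Hi) as [t Ht]. exists (t - T)%Z. rewrite Ht.
    apply block_cases in Hi as [->|[->|[->| ->]]];
      unfold glue_half, comb_half, sel, c1, c2, c3, c4; ring. }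
  assert (Hb : forall i t j, (1 <= i <= 4)%nat -> (j < ns i)%nat ->
    P i = (comb_half c1 c2 c3 c4 i + 2 * t)%Z ->
    b (off ns i + j)%nat = IZR (u (off ns i + j)%nat) + IZR t
      + (if Nat.eqb j 0 then IZR (- comb_int c1 c2 c3 c4 i) else 0)).
  { intros i t j Hi Hj Ht. unfold b.
    rewrite Hau, glue_comb_block, Ht, plus_IZR, mult_IZR, opp_IZR by auto.
    destruct (Nat.eqb j 0); field. }
  assert (Hb0 : inRn (nbar ns 4) b).
  { intros k Hk. unfold b. rewrite Ha, glue_comb_inRn by assumption; ring. }
  split; [assumption|]; split.
  - apply integer_choice. intros k. destruct (Nat.lt_ge_cases k (nbar ns 4)) as [Hk|Hk].
    + destruct (index_split ns k Hk) as (i & j & Hi & Hj & ->).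
      destruct (HD i Hi) as [t Ht]. rewrite (Hb i t j) by assumption.
      destruct (Nat.eqb j 0); eexists; rewrite <- !plus_IZR; reflexivity.
    + exists 0%Z. apply Hb0; assumption.
  - intros i Hi. destruct (HD i Hi) as [t Ht]. destruct (Hns i Hi) as [h Hh].
    change (exists w, bsR ns b i = 2 * IZR w).
    rewrite (bsR_affine ns b (fun k => IZR (u k)) (IZR t) (IZR (- comb_int c1 c2 c3 c4 i)) i)
      by auto.
    rewrite <- IZR_bsZ. fold s.
    (* The left side is 2 s_i - 4T + n_i t, even because n_i is. *)
    assert (E : exists w, (s i + Z.of_nat (ns i) * t - comb_int c1 c2 c3 c4 i = 2 * w)%Z).
    { rewrite Hh. exists (s i - 2 * T + (4 * Z.of_nat h + 2 * Z.of_nat e + 1) * t)%Z.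
      replace (comb_int c1 c2 c3 c4 i) with (4 * T - s i)%Z.
      - rewrite !Nat2Z.inj_add, !Nat2Z.inj_mul. ring.
      - apply block_cases in Hi as [->|[->|[->| ->]]];
          unfold comb_int, sel, c1, c2, c3, c4, T; ring. }
    destruct E as [w Hw]. exists w. rewrite <- mult_IZR, <- Hw.
    rewrite INR_IZR_INZ, opp_IZR, minus_IZR, plus_IZR, mult_IZR. ring.
Qed.

(** Modulo 2 the integer coefficients [comb_int] determine the half-integral ones: applying
    [glue_half] to them returns [comb_half]. So each word is labelled by four bits, and every choice
    of bits occurs. *)
Lemma inL_iff_glue_coset ns e a : block_sizes ns e ->
  inL ns a <-> exists r1 r2 r3 r4, glue_coset ns (sel r1 r2 r3 r4) a.
Proof.
  intros Hns. pose proof (block_sizes_pos _ _ Hns) as Hpos. split.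
  - intros Ha. pose proof (inL_inRn _ _ _ Hns Ha) as Ha0.
    destruct Ha as (c1 & c2 & c3 & c4 & b & (Q1 & (zb & Q2) & Q3) & E).
    set (R' := comb_int c1 c2 c3 c4). set (P' := comb_half c1 c2 c3 c4).
    exists (Z.odd (R' 1%nat)), (Z.odd (R' 2%nat)), (Z.odd (R' 3%nat)), (Z.odd (R' 4%nat)).
    set (r := sel _ _ _ _).
    (* Recognises the first coordinate of each block, where x_2 has its only nonzero entry. *)
    set (first := fun k => existsb (fun i => Nat.eqb k (off ns i)) (seq 1 4)).
    assert (Hfirst : forall i j, (1 <= i <= 4)%nat -> (j < ns i)%nat ->
      first (off ns i + j)%nat = Nat.eqb j 0).
    { intros i j Hi Hj. unfold first, off, nbar.
      pose proof (Hpos 1%nat); pose proof (Hpos 2%nat); pose proof (Hpos 3%nat); pose proof (Hpos 4%nat).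
      apply block_cases in Hi as [->|[->|[->| ->]]]; simpl;
      repeat match goal with
      | |- context [Nat.eqb ?a ?b] => destruct (Nat.eqb_spec a b) end; simpl; try reflexivity; lia. }
    (* The integer part: half of [P'] is rounded down here, and its remainder 0 or 1/2 is supplied
       by [lift]. *)
    set (u := fun k => if Nat.ltb k (nbar ns 4) then
      (zb k + P' (blk ns k) / 2 + if first k then R' (blk ns k) else 0)%Z else 0%Z).
    assert (Hu : forall i j, (1 <= i <= 4)%nat -> (j < ns i)%nat ->
      u (off ns i + j)%nat = (zb (off ns i + j)%nat + P' i / 2 + if Nat.eqb j 0 then R' i else 0)%Z).
    { intros i j Hi Hj. unfold u. rewrite Hfirst, blk_off by assumption.
      pose proof (off_lt ns i j Hi Hj) as L. apply Nat.ltb_lt in L; rewrite L; reflexivity. }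
    exists u. split; [split|].
    + intros k Hk. unfold u. apply Nat.ltb_ge in Hk; rewrite Hk; reflexivity.
    + intros i Hi. destruct (Q3 i Hi) as [t Ht]. destruct (Hns i Hi) as [h Hh].
      assert (EZ : bsZ ns u i = (2 * t + Z.of_nat (ns i) * (P' i / 2) + R' i)%Z).
      { apply eq_IZR. rewrite IZR_bsZ.
        rewrite (bsR_affine ns _ b (IZR (P' i / 2)) (IZR (R' i)) i (Hpos i Hi)).
        - unfold bsR, off. rewrite Ht, INR_IZR_INZ, !plus_IZR, !mult_IZR. reflexivity.
        - intros j Hj. rewrite Hu, Q2, !plus_IZR by assumption.
          destruct (Nat.eqb j 0); reflexivity. }
      rewrite EZ, Hh.
      (* The rounded half occurs n_i times and n_i is even, so only the parity of [R'] survives in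
         the block sum. *)
      replace (Z.of_nat (8 * h + 4 * e + 2)) with (2 * (4 * Z.of_nat h + 2 * Z.of_nat e + 1))%Z by lia.
      rewrite !Z.odd_add, <- !Z.mul_assoc, !Z.odd_mul. simpl (Z.odd 2). rewrite !andb_false_l, !xorb_false_l.
      apply block_cases in Hi as [->|[->|[->| ->]]]; reflexivity.
    + apply functional_extensionality. apply (vec_eq_blocks ns); auto using lift_inRn.
      intros i j Hi Hj. rewrite lift_block, Hu, E, Q2 by assumption.
      pose proof (glue_comb_block ns c1 c2 c3 c4 i j Hpos Hi Hj) as G. unfold glue_comb in G.
      rewrite G. fold P' R'.
      assert (EP : IZR (P' i) / 2 = IZR (P' i / 2) + hf (glue_half xorb r i)).
      { replace (glue_half xorb r i) with (Z.odd (P' i)).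
        - rewrite <- Z.div2_div. pose proof (Z.div2_odd (P' i)) as D. apply (f_equal IZR) in D.
          rewrite plus_IZR, mult_IZR in D. unfold hf. destruct (Z.odd (P' i)); unfold Z.b2z in D; lra.
        - unfold r, P', R', glue_half, comb_half, comb_int.
          apply block_cases in Hi as [->|[->|[->| ->]]]; unfold sel;
            rewrite !Z.odd_add; destruct (Z.odd c1), (Z.odd c2), (Z.odd c3), (Z.odd c4); reflexivity. }
      rewrite EP, !plus_IZR. destruct (Nat.eqb j 0); ring.
  - intros (r1 & r2 & r3 & r4 & u & [Hu Hr] & ->).
    set (r := sel r1 r2 r3 r4) in *.
    apply (inL_intro ns e (fun i => Z.b2z (glue_half xorb r i)) u); auto using lift_inRn.
    + intros i j Hi Hj. rewrite lift_block by assumption. f_equal.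
      unfold hf; destruct (glue_half xorb r i); simpl; lra.
    + assert (X : forall x y, exists t, Z.b2z (xorb (Z.odd x) (Z.odd y)) = (x + y + 2 * t)%Z).
      { intros x y. rewrite <- Z.odd_add. exists (- Z.div2 (x + y))%Z.
        pose proof (Z.div2_odd (x + y)). lia. }
      pose proof (Hr 1%nat ltac:(lia)) as R1. pose proof (Hr 2%nat ltac:(lia)) as R2.
      pose proof (Hr 3%nat ltac:(lia)) as R3. pose proof (Hr 4%nat ltac:(lia)) as R4.
      intros i Hi. unfold glue_half. rewrite <- R1, <- R2, <- R3, <- R4.
      apply block_cases in Hi as [->|[->|[->| ->]]]; apply X.
Qed.

(** The norm of a block is determined modulo 2 by the two bits [r i] and [p i] and by [e]. Each bit
    of [r] enters two entries of [glue_half xorb r], so the number of half-integral blocks is even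
    and the contributions of the common [e] cancel modulo 2; the rest is a check of sixteen
    words. *)
Lemma inL_even ns e a : block_sizes ns e -> inL ns a ->
  exists t : Z, ip (nbar ns 4) a a = 2 * IZR t.
Proof.
  intros Hns Ha. apply (inL_iff_glue_coset _ _ _ Hns) in Ha.
  destruct Ha as (r1 & r2 & r3 & r4 & u & [Hu Hr] & ->).
  set (r := sel r1 r2 r3 r4) in *. set (p := glue_half xorb r).
  assert (B : forall i, (1 <= i <= 4)%nat -> exists s h t,
    bsR ns (fun k => lift ns p u k * lift ns p u k) i
    = IZR (s + 2 * t + Z.b2z (p i) * s + Z.b2z (p i) * (2 * h + Z.of_nat e)) + IZR (Z.b2z (p i)) / 2
    /\ Z.odd s = r i).
  { intros i Hi. destruct (Hns i Hi) as [h Hh].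
    destruct (sumZ_square_parity (ns i) (fun j => u (off ns i + j)%nat)) as [t Ht].
    exists (bsZ ns u i), (Z.of_nat h), t. split; [|apply Hr; assumption].
    unfold bsR.
    rewrite (sumR_ext _ _ (fun j => IZR (u (off ns i + j)%nat * u (off ns i + j)%nat)
      + (2 * hf (p i) * IZR (u (off ns i + j)%nat) + hf (p i) * hf (p i)))).
    - rewrite !sumR_plus, sumR_scal, sumR_const, <- !IZR_sumZ, Ht.
      fold (bsZ ns u i). rewrite INR_IZR_INZ, Hh, !Nat2Z.inj_add, !Nat2Z.inj_mul.
      unfold hf; destruct (p i); unfold Z.b2z; simpl Z.of_nat;
        repeat first [rewrite plus_IZR | rewrite mult_IZR]; field.
    - intros j Hj. rewrite lift_block by assumption. rewrite mult_IZR; ring. }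
  destruct (B 1%nat) as (s1 & h1 & t1 & E1 & O1); [lia|].
  destruct (B 2%nat) as (s2 & h2 & t2 & E2 & O2); [lia|].
  destruct (B 3%nat) as (s3 & h3 & t3 & E3 & O3); [lia|].
  destruct (B 4%nat) as (s4 & h4 & t4 & E4 & O4); [lia|].
  unfold ip. rewrite sumR_blocks, E1, E2, E3, E4.
  pose proof (Z.div2_odd s1) as D1. pose proof (Z.div2_odd s2) as D2.
  pose proof (Z.div2_odd s3) as D3. pose proof (Z.div2_odd s4) as D4.
  rewrite O1 in D1. rewrite O2 in D2. rewrite O3 in D3. rewrite O4 in D4.
  (* Twice the norm, which clears the halves coming from n_i/4 = 2h + e + 1/2; evenness becomes
     divisibility by 4. *)
  set (N := (2 * (s1 + 2 * t1 + Z.b2z (p 1%nat) * s1 + Z.b2z (p 1%nat) * (2 * h1 + Z.of_nat e)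
     + (s2 + 2 * t2 + Z.b2z (p 2%nat) * s2 + Z.b2z (p 2%nat) * (2 * h2 + Z.of_nat e))
     + (s3 + 2 * t3 + Z.b2z (p 3%nat) * s3 + Z.b2z (p 3%nat) * (2 * h3 + Z.of_nat e))
     + (s4 + 2 * t4 + Z.b2z (p 4%nat) * s4 + Z.b2z (p 4%nat) * (2 * h4 + Z.of_nat e)))
     + (Z.b2z (p 1%nat) + Z.b2z (p 2%nat) + Z.b2z (p 3%nat) + Z.b2z (p 4%nat)))%Z).
  assert (HN : exists t, N = (4 * t)%Z).
  { exists (N / 4)%Z. apply Z.div_exact; [lia|]. unfold N, p, r, glue_half, sel in *.
    clear -D1 D2 D3 D4. destruct r1, r2, r3, r4; unfold xorb, Z.b2z in *;
      Z.to_euclidean_division_equations; lia. }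
  destruct HN as [t Ht]. exists t. apply (f_equal IZR) in Ht. unfold N in Ht.
  repeat first [rewrite plus_IZR in Ht | rewrite mult_IZR in Ht].
  repeat first [rewrite plus_IZR | rewrite mult_IZR].
  lra.
Qed.

(** * Positivity and self-duality *)

Lemma sumR_square_ge0 (n : nat) (a : nat -> R) : 0 <= sumR n (fun k => a k * a k).
Proof. induction n as [|n IH]; simpl; [lra|]. nra. Qed.

Lemma ip_self_pos (n : nat) (a : nat -> R) :
  (exists k, (k < n)%nat /\ a k <> 0) -> ip n a a > 0.
Proof.
  intros (k & Hk & Ha). unfold ip. induction n as [|n IH]; [lia|]. simpl.
  pose proof (sumR_square_ge0 n a).
  destruct (Nat.eq_dec k n) as [->|N].
  - assert (0 < a n * a n) by nra. lra.
  - assert (sumR n (fun j => a j * a j) > 0) by (apply IH; lia). nra.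
Qed.

Lemma inL_integral ns e a b : block_sizes ns e -> inL ns a -> inL ns b ->
  exists t : Z, ip (nbar ns 4) a b = IZR t.
Proof.
  intros Hns Ha Hb.
  destruct (inL_even ns e a Hns Ha) as [t1 H1].
  destruct (inL_even ns e b Hns Hb) as [t2 H2].
  destruct (inL_even ns e _ Hns (inL_plus _ _ _ Ha Hb)) as [t3 H3].
  exists (t3 - t1 - t2)%Z. rewrite !minus_IZR.
  assert (E : ip (nbar ns 4) (fun k => a k + b k) (fun k => a k + b k)
    = ip (nbar ns 4) a a + (ip (nbar ns 4) b b + 2 * ip (nbar ns 4) a b)).
  { unfold ip. rewrite <- sumR_scal, <- !sumR_plus. apply sumR_ext; intros k _; ring. }
  lra.
Qed.

(** The vector e_k + c e_l. For k = l and c = 1 it is 2 e_k, the test vector showing that a dual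
    vector has coordinates in (1/2)Z. *)
Definition unit_pair (k l : nat) (c : R) (m : nat) : R :=
  (if Nat.eqb m k then 1 else 0) + (if Nat.eqb m l then c else 0).

Lemma sumR_unit_pair (n k l : nat) (c : R) (x : nat -> R) : (k < n)%nat -> (l < n)%nat ->
  sumR n (fun m => x m * unit_pair k l c m) = x k + c * x l.
Proof.
  intros Hk Hl.
  rewrite (sumR_ext _ _ (fun m => (if Nat.eqb m k then x m else 0) + (if Nat.eqb m l then c * x m else 0))).
  - rewrite sumR_plus, (sumR_delta n k x), (sumR_delta n l (fun m => c * x m)); auto.
  - intros m _. unfold unit_pair. destruct (Nat.eqb m k), (Nat.eqb m l); ring.
Qed.

Lemma inL_unit_pair ns (i j : nat) (c : R) : (1 <= i <= 4)%nat -> (j < ns i)%nat ->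
  c = 1 \/ c = -1 -> inL ns (unit_pair (off ns i + j) (off ns i) c).
Proof.
  intros Hi Hj Hc. apply inL_of_inQ. unfold unit_pair. split; [|split].
  - intros m Hm. pose proof (off_lt ns i j Hi Hj). pose proof (off_lt ns i 0 Hi ltac:(lia)).
    destruct (Nat.eqb_spec m (off ns i + j)); [lia|]. destruct (Nat.eqb_spec m (off ns i)); [lia|]. ring.
  - apply integer_choice. intros m.
    destruct Hc as [-> | ->]; destruct (Nat.eqb m (off ns i + j)), (Nat.eqb m (off ns i));
      rewrite <- plus_IZR; eauto.
  - intros i' Hi'. fold (off ns i').
    destruct (Nat.eq_dec i' i) as [->|N].
    + rewrite (sumR_ext _ _ (fun m => (if Nat.eqb m j then 1 else 0) + (if Nat.eqb m 0 then c else 0))).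
      * rewrite sumR_plus, (sumR_delta _ _ (fun _ => 1)), (sumR_delta _ _ (fun _ => c)) by lia.
        destruct Hc as [-> | ->]; [exists 1%Z|exists 0%Z]; ring.
      * intros m Hm. destruct (Nat.eqb_spec (off ns i + m) (off ns i + j)), (Nat.eqb_spec m j),
          (Nat.eqb_spec (off ns i + m) (off ns i)), (Nat.eqb_spec m 0); try lia; ring.
    + exists 0%Z. rewrite (sumR_ext _ _ (fun _ => 0)); [rewrite sumR_const; ring|].
      intros m Hm. pose proof (blk_off ns i j Hi Hj) as K1.
      pose proof (blk_off ns i 0 Hi ltac:(lia)) as K2. rewrite Nat.add_0_r in K2.
      pose proof (blk_off ns i' m Hi' Hm) as K3.
      destruct (Nat.eqb_spec (off ns i' + m) (off ns i + j)); [congruence|].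
      destruct (Nat.eqb_spec (off ns i' + m) (off ns i)); [congruence|]. ring.
Qed.

Lemma bsR_glue_comb ns (x : nat -> R) c1 c2 c3 c4 i :
  (forall i, (1 <= i <= 4)%nat -> (0 < ns i)%nat) -> (1 <= i <= 4)%nat ->
  bsR ns (fun k => x k * glue_comb ns c1 c2 c3 c4 k) i =
  IZR (comb_half c1 c2 c3 c4 i) / 2 * bsR ns x i + IZR (comb_int c1 c2 c3 c4 i) * x (off ns i).
Proof.
  intros Hpos Hi. unfold bsR.
  rewrite (sumR_ext _ _ (fun j => IZR (comb_half c1 c2 c3 c4 i) / 2 * x (off ns i + j)%nat
    + (if Nat.eqb j 0 then IZR (comb_int c1 c2 c3 c4 i) * x (off ns i + j)%nat else 0))).
  - rewrite sumR_plus, sumR_scal,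
      (sumR_delta _ 0 (fun j => IZR (comb_int c1 c2 c3 c4 i) * x (off ns i + j)%nat)) by auto.
    rewrite Nat.add_0_r; reflexivity.
  - intros j Hj. rewrite glue_comb_block by assumption. destruct (Nat.eqb j 0); ring.
Qed.

(** Pairing with e_k + e_l and e_k - e_l inside a block shows that [x] has there the form integer
    vector plus a constant half-integer P/2. Pairing with the four generators then gives exactly the
    congruences asked for by [inL_intro]. *)
Lemma inL_of_dual ns e x : block_sizes ns e -> inRn (nbar ns 4) x ->
  (forall b, inL ns b -> exists t : Z, ip (nbar ns 4) x b = IZR t) -> inL ns x.
Proof.
  intros Hns Hx HD. pose proof (block_sizes_pos _ _ Hns) as Hpos.
  assert (D1 : forall i j c, (1 <= i <= 4)%nat -> (j < ns i)%nat -> c = 1 \/ c = -1 ->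
    exists t, x (off ns i + j)%nat + c * x (off ns i) = IZR t).
  { intros i j c Hi Hj Hc. destruct (HD _ (inL_unit_pair ns i j c Hi Hj Hc)) as [t Ht].
    exists t. rewrite <- Ht. symmetry; apply sumR_unit_pair.
    - apply off_lt; assumption.
    - pose proof (off_lt ns i 0 Hi (Hpos i Hi)); lia. }
  assert (HP : forall i, exists P : Z, (1 <= i <= 4)%nat -> x (off ns i) = IZR P / 2).
  { intros i. destruct (classic (1 <= i <= 4)%nat) as [Hi|Hi]; [|exists 0%Z; tauto].
    destruct (D1 i 0%nat 1 Hi (Hpos i Hi)) as [t Ht]; auto.
    exists t; intros _. rewrite Nat.add_0_r in Ht. lra. }
  set (P := fun i => proj1_sig (constructive_indefinite_description _ (HP i))).
  assert (EP : forall i, (1 <= i <= 4)%nat -> x (off ns i) = IZR (P i) / 2).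
  { intros i. exact (proj2_sig (constructive_indefinite_description _ (HP i))). }
  assert (HU : exists u : nat -> Z, forall k,
    (if Nat.ltb k (nbar ns 4) then x k - x (off ns (blk ns k)) else 0) = IZR (u k)).
  { apply integer_choice. intros k. destruct (Nat.ltb_spec k (nbar ns 4)) as [Hk|Hk].
    - destruct (index_split ns k Hk) as (i & j & Hi & Hj & ->).
      destruct (D1 i j (-1) Hi Hj) as [t Ht]; auto. exists t.
      rewrite blk_off by assumption. rewrite <- Ht; ring.
    - exists 0%Z; reflexivity. }
  destruct HU as [u HU].
  assert (EU : forall i j, (1 <= i <= 4)%nat -> (j < ns i)%nat ->
     x (off ns i + j)%nat = IZR (u (off ns i + j)%nat) + IZR (P i) / 2).
  { intros i j Hi Hj. rewrite <- HU, blk_off by assumption.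
    pose proof (off_lt ns i j Hi Hj) as L. apply Nat.ltb_lt in L; rewrite L.
    rewrite <- EP by assumption. ring. }
  apply (inL_intro ns e P u); auto.
  assert (ES : forall i, (1 <= i <= 4)%nat -> exists h,
    bsR ns x i = IZR (bsZ ns u i + (2 * h + 1) * P i)).
  { intros i Hi. destruct (Hns i Hi) as [h Hh]. exists (2 * Z.of_nat h + Z.of_nat e)%Z.
    rewrite (bsR_affine ns x (fun k => IZR (u k)) (IZR (P i) / 2) 0 i) by
      (auto; intros j Hj; rewrite EU by assumption; destruct (Nat.eqb j 0); ring).
    rewrite <- IZR_bsZ, INR_IZR_INZ, Hh, !Nat2Z.inj_add, !Nat2Z.inj_mul.
    simpl Z.of_nat. repeat first [rewrite plus_IZR | rewrite mult_IZR]. field. }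
  destruct (ES 1%nat) as [h1 E1]; [lia|]. destruct (ES 2%nat) as [h2 E2]; [lia|].
  destruct (ES 3%nat) as [h3 E3]; [lia|]. destruct (ES 4%nat) as [h4 E4]; [lia|].
  assert (HG : forall c1 c2 c3 c4, exists t,
    (comb_half c1 c2 c3 c4 1 * (bsZ ns u 1 + (2 * h1 + 1) * P 1%nat) + comb_int c1 c2 c3 c4 1 * P 1%nat
     + (comb_half c1 c2 c3 c4 2 * (bsZ ns u 2 + (2 * h2 + 1) * P 2%nat) + comb_int c1 c2 c3 c4 2 * P 2%nat)
     + (comb_half c1 c2 c3 c4 3 * (bsZ ns u 3 + (2 * h3 + 1) * P 3%nat) + comb_int c1 c2 c3 c4 3 * P 3%nat)
     + (comb_half c1 c2 c3 c4 4 * (bsZ ns u 4 + (2 * h4 + 1) * P 4%nat) + comb_int c1 c2 c3 c4 4 * P 4%nat)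
     = 2 * t)%Z).
  { intros c1 c2 c3 c4. destruct (HD _ (inL_glue_comb ns c1 c2 c3 c4)) as [t Ht].
    exists t. unfold ip in Ht. rewrite sumR_blocks, !bsR_glue_comb in Ht by (auto; lia).
    rewrite E1, E2, E3, E4, !EP in Ht by lia.
    apply eq_IZR. rewrite (mult_IZR 2), <- Ht.
    repeat first [rewrite plus_IZR | rewrite mult_IZR]. field. }
  set (s := bsZ ns u) in *. clearbody s P.
  (* For the first generator, P_3 and P_4 occur with the even coefficients 2 h3 + 2 and 2 h4 + 2,
     because n_i/2 is odd. What is left is P_1 = s_3 + s_4 modulo 2; the other three are
     analogous. *)
  destruct (HG 1 0 0 0)%Z as [t1 T1]. destruct (HG 0 1 0 0)%Z as [t2 T2].
  destruct (HG 0 0 1 0)%Z as [t3 T3]. destruct (HG 0 0 0 1)%Z as [t4 T4].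
  unfold comb_half, comb_int, sel in T1, T2, T3, T4.
  intros i Hi. unfold glue_half.
  apply block_cases in Hi as [->|[->|[->| ->]]]; unfold sel.
  - exists (t1 - s 3%nat - s 4%nat - (h3 + 1) * P 3%nat - (h4 + 1) * P 4%nat)%Z. lia.
  - exists (t2 - s 4%nat - s 1%nat - (h4 + 1) * P 4%nat - (h1 + 1) * P 1%nat)%Z. lia.
  - exists (t3 - s 1%nat - s 2%nat - (h1 + 1) * P 1%nat - (h2 + 1) * P 2%nat)%Z. lia.
  - exists (t4 - s 2%nat - s 3%nat - (h2 + 1) * P 2%nat - (h3 + 1) * P 3%nat)%Z. lia.
Qed.

(** * The theta series *)

(** The numerator of rho_{k-1}, defined for k = 0 as well, where it is zero by Jacobi's identity. *)
Definition odd_power_defect (z : C) (k : nat) : C :=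
  Cminus (Cminus (Complex.Cpow (theta3 z) (8 * k + 4)) (Complex.Cpow (theta2 z) (8 * k + 4)))
    (Complex.Cpow (theta4 z) (8 * k + 4)).

Lemma Cpow_0_pos (k : nat) : (0 < k)%nat -> Complex.Cpow (RtoC 0) k = RtoC 0.
Proof. destruct k; [lia|]; intros _; simpl; ring. Qed.

Lemma Cmult_eq_0 (v w : C) : Cmult v w = RtoC 0 -> v = RtoC 0 \/ w = RtoC 0.
Proof.
  intros H. apply NNPP; intros N. apply not_or_and in N as [N1 N2].
  exact (Cmult_neq_0 _ _ N1 N2 H).
Qed.

(* With x = theta3^4, y = theta2^4, w = theta4^4 and x = y + w, the odd power
   x^(2k+1) - y^(2k+1) - w^(2k+1) vanishes as soon as one of x, y, w does. *)
Lemma odd_power_defect_zero (z : C) (k : nat) : Im z > 0 ->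
  Cmult (Cmult (theta2 z) (theta3 z)) (theta4 z) = RtoC 0 -> odd_power_defect z k = RtoC 0.
Proof.
  intros Hz H0. pose proof (jacobi z Hz) as J. unfold odd_power_defect.
  replace (8 * k + 4)%nat with (4 * (2 * k + 1))%nat by lia.
  rewrite !Cpow_mult_r, J.
  apply Cmult_eq_0 in H0 as [H0|H0]; [apply Cmult_eq_0 in H0 as [H0|H0]|].
  - rewrite H0, (Cpow_0_pos 4), (Cpow_0_pos (2 * k + 1)), Cplus_0_l by lia. ring.
  - rewrite H0, (Cpow_0_pos 4) in J by lia. rewrite <- J, (Cpow_0_pos (2 * k + 1)) by lia.
    replace (Complex.Cpow (theta4 z) 4) with (Copp (Complex.Cpow (theta2 z) 4)).
    + rewrite Cpow_opp. unfold sg. replace (Z.of_nat (2 * k + 1)) with (1 + 2 * Z.of_nat k)%Z by lia.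
      rewrite Z.odd_add, Z.odd_mul. simpl (true && _).
      replace (RtoC (-1)) with (Copp (RtoC 1)) by (apply injective_projections; simpl; ring). ring.
    + set (y := Complex.Cpow (theta2 z) 4) in *. set (w := Complex.Cpow (theta4 z) 4) in *.
      replace w with (Cminus (Cplus y w) y) by ring. rewrite <- J; ring.
  - rewrite H0, (Cpow_0_pos 4), (Cpow_0_pos (2 * k + 1)), Cplus_0_r by lia. ring.
Qed.

(** The index shift lets one formula cover rho_{-1} and the genuine quotients, without deciding
    whether a theta function vanishes at [z]. *)
Lemma rho_pred (z : C) (k : nat) : Im z > 0 ->
  Cmult (rho (Z.of_nat k - 1) z) (Complex.Cpow (Cmult (Cmult (theta2 z) (theta3 z)) (theta4 z)) 4)
  = odd_power_defect z k.
Proof.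
  intros Hz. destruct (eqdec (Cmult (Cmult (theta2 z) (theta3 z)) (theta4 z)) (RtoC 0)) as [E|E].
  (* Here the quotient in [rho] is a division by zero; whatever its value, it is multiplied by 0. *)
  - rewrite E, (Cpow_0_pos 4), Cmult_0_r by lia. symmetry; apply odd_power_defect_zero; assumption.
  - unfold rho. destruct (Z.ltb_spec (Z.of_nat k - 1) 0) as [L|L].
    + replace k with 0%nat by lia. unfold odd_power_defect. simpl (8 * 0 + 4)%nat.
      rewrite (jacobi z Hz). ring.
    + replace (Z.to_nat (Z.of_nat k - 1) + 1)%nat with k by lia.
      cbv zeta. rewrite !Cpow_Defs. fold (odd_power_defect z k).
      unfold Cdiv. rewrite <- Cmult_assoc, Cinv_l, Cmult_1_r; [reflexivity|].
      revert E. generalize (Cmult (Cmult (theta2 z) (theta3 z)) (theta4 z)); intros w E.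
      simpl. rewrite Cmult_1_r. repeat apply Cmult_neq_0; assumption.
Qed.

(** The eighth power in Delta_24 splits into two fourth powers, one for each denominator, and 32/2^8
    = 1/8. *)
Lemma Delta24_rho_rho (z : C) (k k' : nat) : Im z > 0 ->
  Cmult (Cmult (RtoC 32) (Delta24 z)) (Cmult (rho (Z.of_nat k - 1) z) (rho (Z.of_nat k' - 1) z))
  = Cmult (RtoC (/ 8)) (Cmult (odd_power_defect z k) (odd_power_defect z k')).
Proof.
  intros Hz. rewrite <- !rho_pred by assumption. unfold Delta24. rewrite Cpow_Defs.
  replace (RtoC (/ 8)) with (Cdiv (RtoC 1) (RtoC 8)) by (rewrite RtoC_inv by lra; unfold Cdiv; ring).
  field.
Qed.

Lemma theta_series_value (m1 m2 m3 m4 eps : nat) (z : C) : Im z > 0 ->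
  let ns := blocks m1 m2 m3 m4 eps in
  sum_bool (fun r1 => sum_bool (fun r2 => sum_bool (fun r3 => sum_bool (fun r4 =>
    let r := sel r1 r2 r3 r4 in let p := glue_half xorb r in
    Cmult (block_factor z ns p r 1) (Cmult (block_factor z ns p r 2)
      (Cmult (block_factor z ns p r 3) (block_factor z ns p r 4))))))) =
  Cminus
    (Cmult (RtoC (/ 2)) (hh (m1 + m2 + m3 + m4 + 2 * eps + 1) z))
    (Cmult (Cmult (RtoC 32) (Delta24 z))
       (Cplus (Cplus
          (Cmult (rho (Z.of_nat (m1 + m2 + eps) - 1) z) (rho (Z.of_nat (m3 + m4 + eps) - 1) z))
          (Cmult (rho (Z.of_nat (m1 + m3 + eps) - 1) z) (rho (Z.of_nat (m2 + m4 + eps) - 1) z)))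
          (Cmult (rho (Z.of_nat (m1 + m4 + eps) - 1) z) (rho (Z.of_nat (m2 + m3 + eps) - 1) z)))).
Proof.
  intros Hz ns. rewrite !Cmult_plus_distr_l, !Delta24_rho_rho by assumption.
  unfold hh. rewrite !Cpow_Defs.
  set (n1 := ns 1%nat). set (n2 := ns 2%nat). set (n3 := ns 3%nat). set (n4 := ns 4%nat).
  replace (8 * (m1 + m2 + m3 + m4 + 2 * eps + 1))%nat with (n1 + n2 + n3 + n4)%nat
    by (unfold n1, n2, n3, n4, ns, blocks; lia).
  unfold odd_power_defect.
  replace (8 * (m1 + m2 + eps) + 4)%nat with (n1 + n2)%nat by (unfold n1, n2, ns, blocks; lia).
  replace (8 * (m1 + m3 + eps) + 4)%nat with (n1 + n3)%nat by (unfold n1, n3, ns, blocks; lia).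
  replace (8 * (m1 + m4 + eps) + 4)%nat with (n1 + n4)%nat by (unfold n1, n4, ns, blocks; lia).
  replace (8 * (m2 + m3 + eps) + 4)%nat with (n2 + n3)%nat by (unfold n2, n3, ns, blocks; lia).
  replace (8 * (m2 + m4 + eps) + 4)%nat with (n2 + n4)%nat by (unfold n2, n4, ns, blocks; lia).
  replace (8 * (m3 + m4 + eps) + 4)%nat with (n3 + n4)%nat by (unfold n3, n4, ns, blocks; lia).
  rewrite !Cpow_add_r.
  (* The blocks are nonempty, so no 0^0 = 1 arises and both half-integral cosets reduce to
     theta_2^n/2. *)
  assert (Z0 : forall i, (1 <= i <= 4)%nat -> Complex.Cpow (theta z true true) (ns i) = RtoC 0).
  { intros i Hi. rewrite theta_half_sign by assumption. apply Cpow_0_pos.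
    unfold ns; apply block_cases in Hi as [->|[->|[->| ->]]]; unfold blocks; lia. }
  unfold sum_bool, block_factor, glue_half, sel, xorb. cbv beta iota zeta.
  rewrite !Z0 by lia. rewrite <- !theta2_eq, <- !theta3_eq, <- !theta4_eq.
  (* The exponents are now forgotten: the remaining claim is a polynomial identity in twelve
     independent variables, the n_i-th powers of the three theta functions. Jacobi's identity has
     done its work in [rho_pred]. *)
  fold n1 n2 n3 n4. clearbody n1 n2 n3 n4. clear.
  generalize (Complex.Cpow (theta2 z) n1) (Complex.Cpow (theta2 z) n2) (Complex.Cpow (theta2 z) n3) (Complex.Cpow (theta2 z) n4).
  generalize (Complex.Cpow (theta3 z) n1) (Complex.Cpow (theta3 z) n2) (Complex.Cpow (theta3 z) n3) (Complex.Cpow (theta3 z) n4).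
  generalize (Complex.Cpow (theta4 z) n1) (Complex.Cpow (theta4 z) n2) (Complex.Cpow (theta4 z) n3) (Complex.Cpow (theta4 z) n4).
  intros. replace (RtoC (/ 2)) with (Cdiv (RtoC 1) (RtoC 2)) by (rewrite RtoC_inv by lra; unfold Cdiv; ring).
  replace (RtoC (/ 8)) with (Cdiv (RtoC 1) (RtoC 8)) by (rewrite RtoC_inv by lra; unfold Cdiv; ring).
  field.
Qed.

Theorem theorem3p3 (m1 m2 m3 m4 eps : nat) (Heps : (eps <= 1)%nat) :
  let ns := blocks m1 m2 m3 m4 eps in
  let n := nbar ns 4 in
  (* positive definite *)
  (forall a, inL ns a -> (exists k, (k < n)%nat /\ a k <> 0) -> ip n a a > 0) /\
  (* even *)
  (forall a, inL ns a -> exists t : Z, ip n a a = 2 * IZR t) /\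
  (* unimodular: L equals its dual *)
  (forall x, inRn n x ->
     (inL ns x <-> forall b, inL ns b -> exists t : Z, ip n x b = IZR t)) /\
  (* theta series *)
  (forall z : C, Im z > 0 ->
     HasSum (inL ns) (fun a => qpow z (ip n a a))
       (Cminus
          (Cmult (RtoC (/ 2)) (hh (m1 + m2 + m3 + m4 + 2 * eps + 1) z))
          (Cmult (Cmult (RtoC 32) (Delta24 z))
             (Cplus (Cplus
                (Cmult (rho (Z.of_nat (m1 + m2 + eps) - 1) z) (rho (Z.of_nat (m3 + m4 + eps) - 1) z))
                (Cmult (rho (Z.of_nat (m1 + m3 + eps) - 1) z) (rho (Z.of_nat (m2 + m4 + eps) - 1) z)))
                (Cmult (rho (Z.of_nat (m1 + m4 + eps) - 1) z) (rho (Z.of_nat (m2 + m3 + eps) - 1) z)))))).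
Proof.
  intros ns n.
  assert (Hns : block_sizes ns eps).
  { intros i Hi; unfold ns; apply block_cases in Hi as [->|[->|[->| ->]]]; unfold blocks; eauto. }
  repeat split.
  - intros a _; apply ip_self_pos.
  - intros a Ha. eapply inL_even; eauto.
  - intros Hx b Hb. eapply inL_integral; eauto.
  - intros HD. eapply inL_of_dual; eauto.
  - intros z Hz. unfold ns. rewrite <- theta_series_value by assumption. fold ns.
    pose proof (HasSum_glue_cosets z ns (block_sizes_pos _ _ Hns) Hz) as H.
    revert H; apply HasSum_ext; [|reflexivity].
    intros a; symmetry; apply (inL_iff_glue_coset ns eps a Hns).
Qed.
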